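(* Let $m$ be a positive integer, let $I$ be a nonempty symmetrical subset of $\{1,\dots,p-1\}$, and let $\phi$ be a Whittaker function on $\mathfrak h_I^+$ such that $l_i:=\phi(C_i)\ne0$ and $\phi(I_n^{(i)})=0$ for all $i\in I$ and $n\ge m$. Then there is a $\mathfrak g$-module structure on the polynomial ring $P_I=\mathbb C[t_{n,i}\mid n\in\mathbb Z_+,i\in I]$ such that $$I_{-n}^{(i)}\mapsto t_{n,i},\quad I_{n-1}^{(p-i)}\mapsto\phi(C_i)\Bigl(n-\frac ip\Bigr)\frac{\partial}{\partial t_{n,i}}+\phi\bigl(I_{n-1}^{(p-i)}\bigr),\quad C_i\mapsto\phi(C_i)\qquad(i\in I,\ n\in\mathbb Z_+),$$ $$I_n^{(j)}\mapsto0,\quad C_j\mapsto0,\quad C_0\mapsto|I|\qquad(j\in I^C,\ n\in\mathbb Z),$$ and, for $n\in\mathbb Z$, $$L_n\mapsto\sum_{j\in I}\frac1{2l_j}\Bigl(\sum_{k\in\mathbb Z}:I_k^{(j)}I_{n-k-1}^{(p-j)}:\Bigr)+\delta_{n,0}\sum_{j\in I}\frac{j(p-j)}{4p^2},$$ where $:I_k^{(i)}I_l^{(p-i)}:$ equals $I_k^{(i)}I_l^{(p-i)}$ if $k<l$ and $I_l^{(p-i)}I_k^{(i)}$ if $k\ge l$. Furthermore, the resulting $\mathfrak g$-module is an irreducible Whittaker module of type $\phi^e$.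
   Context: All vector spaces and algebras are over $\mathbb C$; $\mathbb N=\{0,1,2,\dots\}$, $\mathbb Z_+=\{1,2,\dots\}$; $p>1$ is a fixed integer. Gap-$p$ Virasoro algebra. $\mathfrak g$ is the Lie algebra with basis $\{L_n, I_n^{(i)}, C_j : n\in\mathbb Z, 1\le i\le p-1, 0\le j\le \lfloor p/2\rfloor\}$ and brackets $[L_m,L_n]=(m-n)L_{m+n}+\frac1{12}(m^3-m)\delta_{m+n,0}C_0$, $[I_m^{(i)},I_n^{(j)}]=(m+\frac ip)\delta_{i+j,p}\delta_{m+n+1,0}C_i$, $[L_m,I_n^{(i)}]=-(n+\frac ip)I_{m+n}^{(i)}$, all $C_k$ central; one sets $C_i:=C_{p-i}$ for $\lfloor p/2\rfloor<i\le p-1$. A subset $I\subseteq\{1,\dots,p-1\}$ is symmetrical if $i\in I$ implies $p-i\in I$; $I^C=\{1,\dots,p-1\}\setminus I$. Put $\mathfrak h_I^+=\mathrm{Span}\{I_n^{(i)},C_i: i\in I,n\in\mathbb N\}$ and $\mathfrak g^{(m)}=\mathrm{Span}\{L_{m+k},I_k^{(i)},C_0,C_i: k\in\mathbb N,1\le i\le p-1\}$, subalgebras of $\mathfrak g$. A Whittaker function on a subalgebra $\mathcal K$ (here $\mathfrak h_I^+$ or $\mathfrak g^{(m)}$) is a Lie algebra homomorphism $\chi:\mathcal K\to\mathbb C$. A $\mathfrak g$-module is a Whittaker module of type $\chi$ ($\chi$ a Whittaker function on $\mathfrak g^{(m)}$) if it is generated by a vector $v$ with $xv=\chi(x)v$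 for all $x\in\mathfrak g^{(m)}$. $\phi^e$ is the Whittaker function on $\mathfrak g^{(m)}$ extending $\phi$ with $\phi^e(I_n^{(i)})=\phi^e(C_i)=0$ for $i\in I^C,n\in\mathbb N$; $\phi^e(C_0)=|I|$; $\phi^e(L_n)=0$ for $n>2m$; and $\phi^e(L_n)=\sum_{j\in I}\frac1{2l_j}\sum_{k=0}^{m-1}\phi(I_k^{(j)})\phi(I_{n-k-1}^{(p-j)})$ for $m\le n\le2m$. *)

(* Defs.v *)
From HB Require Import structures.
From mathcomp Require Import all_boot all_order all_algebra finmap.
From mathcomp Require Import monalg.
From mathcomp Require Import boolp classical_sets cardinality fsbigop reals.
From mathcomp Require Import complex ring lra zify.

Set Implicit Arguments.
Unset Strict Implicit.
Unset Printing Implicit Defensive.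

Import Order.TTheory GRing.Theory Num.Theory.
Local Open Scope classical_set_scope.
Local Open Scope ring_scope.

HB.mixin Record isLieAlgebra (K : fieldType) L of GRing.Lmodule K L := {
  lie : L -> L -> L;
  lie_linearl : forall z, linear (lie^~ z);
  lie_linearr : forall x, linear (lie x);
  lie_alternating : forall x, lie x x = 0;
  lie_jacobi : forall x y z,
    lie x (lie y z) + lie y (lie z x) + lie z (lie x y) = 0
}.

#[short(type="lieAlgType")]
HB.structure Definition LieAlgebra (K : fieldType) :=
  {L of isLieAlgebra K L & GRing.Lmodule K L}.

Definition is_subspace (K : fieldType) (V : lmodType K) (W : set V) : Prop :=
  W 0 /\ forall (a : K) u v, W u -> W v -> W (a *: u + v).

Definition lspan (K : fieldType) (V : lmodType K) (S : set V) : set V :=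
  smallest (@is_subspace K V) S.

Lemma lspan_subspace (K : fieldType) (V : lmodType K) (S : set V) :
  is_subspace (lspan S).
Proof.
split=> [W [[W0 _] _]//|a u v Su Sv W [sW SW]].
by apply: sW.2; [apply: Su|apply: Sv].
Qed.

Record lie_subalgebra (K : fieldType) (L : lieAlgType K) := LieSubalgebra {
  subalg_carrier :> L -> Prop;
  subalg_subspace : is_subspace subalg_carrier;
  subalg_lie : forall x y,
    subalg_carrier x -> subalg_carrier y -> subalg_carrier (lie x y)
}.

Lemma lspan_lie (K : fieldType) (L : lieAlgType K) (S : set L) :
  (forall x y, S x -> S y -> lspan S (lie x y)) ->
  forall x y, lspan S x -> lspan S y -> lspan S (lie x y).
Proof.
move=> SS x y Sx Sy; have [S0 SD] := lspan_subspace S.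
move: x Sx; apply: smallest_sub; first split.
- suff -> : lie 0 y = 0 by [].
  by have := lie_linearl y 1 0 0; rewrite !scale1r addr0 => /eqP;
    rewrite -subr_eq subrr eq_sym => /eqP.
- by move=> a u v Su Sv; rewrite lie_linearl; apply: SD.
move=> x Sx; move: y Sy; apply: smallest_sub; first split.
- suff -> : lie x 0 = 0 by [].
  by have := lie_linearr x 1 0 0; rewrite !scale1r addr0 => /eqP;
    rewrite -subr_eq subrr eq_sym => /eqP.
- by move=> a u v Su Sv; rewrite lie_linearr; apply: SD.
- by move=> y Sy; apply: SS.
Qed.

Definition span_subalgebra (K : fieldType) (L : lieAlgType K) (S : set L)
    (SS : forall x y, S x -> S y -> lspan S (lie x y)) : lie_subalgebra L :=
  LieSubalgebra (lspan_subspace S) (lspan_lie SS).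

Record lie_module (K : fieldType) (L : lieAlgType K) (V : lmodType K) :=
  LieModule {
    act :> L -> V -> V;
    act_linearl : forall v, linear (act^~ v);
    act_linearr : forall x, linear (act x);
    act_lie : forall x y v, act (lie x y) v = act x (act y v) - act y (act x v)
  }.

Section LieModuleNotions.
Context (K : fieldType) (L : lieAlgType K) (V : lmodType K).
Implicit Type A : lie_module L V.

Definition is_submodule A (W : set V) : Prop :=
  is_subspace W /\ forall x v, W v -> W (A x v).

Definition irreducible_module A : Prop :=
  (exists v : V, v != 0) /\
  forall W, is_submodule A W -> W = [set 0] \/ W = [set: V].

Definition generated_by A (v : V) : Prop :=
  smallest (is_submodule A) [set v] = [set: V].

(* A Lie algebra homomorphism from the subalgebra S to the abelian Lie algebra
   K; the values of chi outside S are irrelevant. *)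
Definition whittaker_function (S : lie_subalgebra L) (chi : L -> K) : Prop :=
  (forall a x y, S x -> S y -> chi (a *: x + y) = a * chi x + chi y) /\
  (forall x y, S x -> S y -> chi (lie x y) = 0).

Definition whittaker_module (S : lie_subalgebra L) (chi : L -> K) A : Prop :=
  whittaker_function S chi /\
  exists v : V, (forall x, S x -> A x v = chi x *: v) /\ generated_by A v.

End LieModuleNotions.

HB.lock Definition lin_ext (K : fieldType) (B : choiceType) (V : lmodType K)
    (f : B -> V) (x : {malg K[B]}) : V := \sum_(b <- msupp x) x@_b *: f b.
Arguments lin_ext {K B V}.

Section LinearExtension.
Context (K : fieldType) (B : choiceType) (V : lmodType K).

Lemma lin_extE (f : B -> V) x : lin_ext f x = \sum_(b <- msupp x) x@_b *: f b.
Proof. by rewrite lin_ext.unlock. Qed.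

Lemma lin_extEw (f : B -> V) (d : {fset B}) x : (msupp x `<=` d)%fset ->
  lin_ext f x = \sum_(b <- d) x@_b *: f b.
Proof.
move=> sxd; rewrite lin_extE (big_fset_incl _ sxd)//= => b _ /mcoeff_outdom ->.
by rewrite scale0r.
Qed.

Lemma lin_ext_linear (f : B -> V) : linear (lin_ext f).
Proof.
move=> a x y; pose d := (msupp x `|` msupp y)%fset.
rewrite !(@lin_extEw _ d) ?fsubsetUl ?fsubsetUr//; last first.
  apply: fsubset_trans (msuppD_le _ _) _; apply: fsetUSS => //.
  exact: msuppZ_le.
rewrite scaler_sumr -big_split; apply: eq_bigr => b _ /=.
by rewrite mcoeffD mcoeffZ scalerDl scalerA.
Qed.

Lemma lin_extU (f : B -> V) b : lin_ext f << b >> = f b.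
Proof. by rewrite lin_extE msuppU oner_eq0 big_seq_fset1 mcoeffUU scale1r. Qed.

Lemma malg_ind (P : {malg K[B]} -> Prop) :
    P 0 -> (forall a x y, P x -> P y -> P (a *: x + y)) ->
  (forall b, P << b >>) -> forall x, P x.
Proof.
move=> P0 PD PU x; rewrite (monalgE x).
elim: (X in \sum_(k <- X) _) => [|b s IHs]; first by rewrite big_nil.
rewrite big_cons; suff -> : << x@_b *g b >> = x@_b *: << b >> by apply: PD.
by apply/malgP => k; rewrite mcoeffZ !mcoeffU mulrnAr mulr1.
Qed.

End LinearExtension.

(* The indices i with 1 <= i <= p - 1. *)
Definition gapidx (p : nat) : Type := {i : 'I_p | (0 < i)%N}.
HB.instance Definition _ p := Finite.on (gapidx p).
Definition gapidx_nat p (i : gapidx p) : nat := val i.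
Coercion gapidx_nat : gapidx >-> nat.

Lemma gapidx_gt0 p (i : gapidx p) : (0 < i)%N. Proof. exact: (valP i). Qed.
Lemma gapidx_lt p (i : gapidx p) : (i < p)%N. Proof. exact: ltn_ord. Qed.

Lemma gapidx_opp_lt p (i : gapidx p) : (p - i < p)%N.
Proof. by have := gapidx_gt0 i; have := gapidx_lt i; lia. Qed.

Lemma gapidx_opp_gt0 p (i : gapidx p) : (0 < Ordinal (gapidx_opp_lt i))%N.
Proof. by rewrite subn_gt0 gapidx_lt. Qed.

(* i |-> p - i *)
Definition gapidx_opp p (i : gapidx p) : gapidx p :=
  exist _ (Ordinal (gapidx_opp_lt i)) (gapidx_opp_gt0 i).

Definition symmetrical p (I : {set gapidx p}) : Prop :=
  forall i, i \in I -> gapidx_opp i \in I.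

Inductive gapbasis (p : nat) : Type :=
  | bL of int
  | bI of int & gapidx p
  | bC of 'I_p./2.+1.
Arguments bL {p}.

Section GapBasisChoice.
Variable p : nat.
Definition gapbasis_code (b : gapbasis p) : int + int * gapidx p + 'I_p./2.+1 :=
  match b with
  | bL n => inl (inl n) | bI n i => inl (inr (n, i)) | bC c => inr c
  end.
Definition gapbasis_decode (s : int + int * gapidx p + 'I_p./2.+1) :=
  match s with
  | inl (inl n) => bL n | inl (inr (n, i)) => bI n i | inr c => bC c
  end.
Lemma gapbasis_codeK : cancel gapbasis_code gapbasis_decode.
Proof. by case. Qed.
HB.instance Definition _ := Choice.copy (gapbasis p) (can_type gapbasis_codeK).
End GapBasisChoice.

Definition gapvir (K : numFieldType) (p : nat) : Type := {malg K[gapbasis p]}.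
HB.instance Definition _ K p := GRing.Lmodule.on (gapvir K p).

HB.lock Definition gapgen (K : numFieldType) (p : nat) (b : gapbasis p) :
  gapvir K p := << b >>.

Section GapBracket.
Context (K : numFieldType) (p : nat).
Notation g := (gapvir K p).

Definition Lgen (n : int) : g := gapgen K (bL n).
Definition Igen (n : int) (i : gapidx p) : g := gapgen K (bI n i).
Definition C0gen : g := gapgen K (bC ord0).

Definition centridx (i : gapidx p) : 'I_p./2.+1 :=
  inord (if (i <= p./2)%N then i : nat else p - i)%N.

(* C_i for 1 <= i <= p - 1, with the convention C_i = C_{p-i} for i > p/2. *)
Definition Cgen (i : gapidx p) : g := gapgen K (bC (centridx i)).

Definition gapbr (a b : gapbasis p) : g :=
  match a, b with
  | bL m, bL n => (m - n)%:~R *: Lgen (m + n)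
      + ((m ^+ 3 - m)%:~R / 12%:R * (m + n == 0)%:R) *: C0gen
  | bI m i, bI n j =>
      ((m%:~R + i%:R / p%:R) * (i + j == p)%N%:R * (m + n + 1 == 0)%:R)
        *: Cgen i
  | bL m, bI n i => - (n%:~R + i%:R / p%:R) *: Igen (m + n) i
  | bI n i, bL m => (n%:~R + i%:R / p%:R) *: Igen (m + n) i
  | _, _ => 0
  end.

End GapBracket.

HB.lock Definition gaplie (K : numFieldType) (p : nat) (x y : gapvir K p) :
  gapvir K p := lin_ext (fun a => lin_ext (gapbr K a) y) x.
Arguments gaplie {K p}.

Section GapVirasoroLie.
Context (K : numFieldType) (p : nat).
Notation g := (gapvir K p).
Notation Lgen := (@Lgen K p).
Notation Igen := (@Igen K p).
Notation C0gen := (@C0gen K p).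
Notation Cgen := (@Cgen K p).
Notation gaplie := (@gaplie K p).

Lemma gaplieE (x y : g) :
  gaplie x y = lin_ext (fun a => lin_ext (gapbr K a) y) x.
Proof. by rewrite gaplie.unlock. Qed.

Lemma gaplie_linearl z : linear (gaplie^~ z).
Proof. by move=> a x y; rewrite !gaplieE lin_ext_linear. Qed.

Lemma gaplie_linearr x : linear (gaplie x).
Proof.
move=> a y z; rewrite !gaplieE !lin_extE scaler_sumr -big_split.
apply: eq_bigr => b _; rewrite [X in _ *: X]lin_ext_linear scalerDr !scalerA /=.
by rewrite [a * _]mulrC.
Qed.

Lemma gaplieU (a b : gapbasis p) : gaplie (gapgen K a) (gapgen K b) = gapbr K a b.
Proof. by rewrite gaplieE gapgen.unlock !lin_extU. Qed.

Lemma gapvir_ind (P : g -> Prop) :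
    P 0 -> (forall a x y, P x -> P y -> P (a *: x + y)) ->
  (forall b, P (gapgen K b)) -> forall x, P x.
Proof.
move=> P0 PD PU; apply: malg_ind => // b.
by have := PU b; rewrite gapgen.unlock.
Qed.

Lemma gaplie0l y : gaplie 0 y = 0 :> g.
Proof. by rewrite gaplieE lin_extE msupp0 big_seq_fset0. Qed.

Lemma gaplie0r x : gaplie x 0 = 0 :> g.
Proof.
rewrite gaplieE lin_extE big1 // => b _.
by rewrite lin_extE msupp0 big_seq_fset0 scaler0.
Qed.

Lemma gaplieZl a x y : gaplie (a *: x) y = a *: gaplie x y.
Proof. by rewrite -[a *: x]addr0 gaplie_linearl gaplie0l addr0. Qed.

Lemma gaplieZr a x y : gaplie x (a *: y) = a *: gaplie x y.
Proof. by rewrite -[a *: y]addr0 gaplie_linearr gaplie0r addr0. Qed.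

Lemma gaplieDr x y z : gaplie x (y + z) = gaplie x y + gaplie x z.
Proof. by have := gaplie_linearr x 1 y z; rewrite !scale1r. Qed.

Lemma gapidx_ratN (i j : gapidx p) : (i + j == p)%N ->
  j%:R / p%:R = 1 - i%:R / p%:R :> K.
Proof.
move=> /eqP ij; have p0 : p%:R != 0 :> K.
  by rewrite pnatr_eq0; have := gapidx_lt i; lia.
have -> : j%:R = p%:R - i%:R :> K.
  by apply/eqP; rewrite eq_sym subr_eq -natrD addnC ij.
by field.
Qed.

Lemma Cgen_sym (i j : gapidx p) : (i + j == p)%N -> Cgen j = Cgen i.
Proof.
move=> /eqP ij; rewrite /Cgen; suff -> : centridx j = centridx i by [].
have := gapidx_gt0 i; have := gapidx_gt0 j => j0 i0.
by rewrite /centridx; congr inord; do 2![case: ifP => ?]; lia.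
Qed.

Let scale2 (V : lmodType K) (a b : K) (v : V) :
  a + b = 0 -> a *: v + b *: v = 0.
Proof. by move=> ab; rewrite -scalerDl ab scale0r. Qed.

Let scale3 (V : lmodType K) (a b c : K) (v : V) :
  a + b + c = 0 -> a *: v + b *: v + c *: v = 0.
Proof. by move=> abc; rewrite -!scalerDl abc scale0r. Qed.

Let scale22 (V : lmodType K) (a b c d : K) (v w : V) :
  a + b = 0 -> c + d = 0 -> (a *: v + c *: w) + (b *: v + d *: w) = 0.
Proof. by move=> ab cd; rewrite addrACA !scale2 ?addr0. Qed.

Let scale33 (V : lmodType K) (a b c d e f : K) (v w : V) :
  a + b + c = 0 -> d + e + f = 0 ->
  (a *: v + d *: w) + (b *: v + e *: w) + (c *: v + f *: w) = 0.
Proof. move=> abc def; rewrite (addrACA (a *: v)) [LHS]addrACA.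
by rewrite (scale3 _ abc) (scale3 _ def) addr0. Qed.

Let lin3 (V : lmodType K) (a : K) (u v w u' v' w' : V) :
  (a *: u + u') + (a *: v + v') + (a *: w + w') =
  a *: (u + v + w) + (u' + v' + w').
Proof. by rewrite (addrACA (a *: u)) [LHS]addrACA -!scalerDr. Qed.

Let zero2 (V : lmodType K) (a b : K) (v w : V) :
  a = 0 -> b = 0 -> a *: v + b *: w = 0.
Proof. by move=> -> ->; rewrite !scale0r addr0. Qed.

Let double_eq0 (V : lmodType K) (v : V) : v + v = 0 -> v = 0.
Proof.
rewrite -mulr2n -scaler_nat => /eqP.
by rewrite scaler_eq0 pnatr_eq0 => /eqP.
Qed.

Lemma gapbr_anti (a b : gapbasis p) : gapbr K a b + gapbr K b a = 0.
Proof.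
case: a b => [m|m i|c] [n|n j|d] //=; rewrite ?addr0 //.
- rewrite [n + m]addrC; apply: scale22; first by ring.
  case: eqP => [mn|_]; last by rewrite /= mulr0n !mulr0 addr0.
  by have -> : n = - m by [lia]; field.
- by rewrite scaleNr addNr.
- by rewrite scaleNr addrN.
- rewrite [(j + i)%N]addnC [n + m]addrC.
  case: (boolP (i + j == p)%N) => [ij|_]; last first.
    by apply: zero2; rewrite /= mulr0n mulr0 ?mul0r.
  case: eqP => [mn|_]; last by apply: zero2; rewrite /= mulr0n mulr0 ?mul0r.
  rewrite (Cgen_sym ij); apply: scale2; rewrite (gapidx_ratN ij).
  by have -> : n = - m - 1 by [lia]; ring.
Qed.

Lemma gaplie_anti x y : gaplie x y + gaplie y x = 0.
Proof.
move: x; apply: gapvir_ind => [|a x x' hx hx'|b].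
- by rewrite gaplie0l gaplie0r addr0.
- by rewrite gaplie_linearl gaplie_linearr addrACA hx' addr0 -scalerDr hx scaler0.
move: y; apply: gapvir_ind => [|a x x' hx hx'|c].
- by rewrite gaplie0l gaplie0r addr0.
- by rewrite gaplie_linearl gaplie_linearr addrACA hx' addr0 -scalerDr hx scaler0.
by rewrite !gaplieU gapbr_anti.
Qed.

Lemma gaplie_alt x : gaplie x x = 0.
Proof. exact/double_eq0/gaplie_anti. Qed.

Let jac x y z :=
  gaplie x (gaplie y z) + gaplie y (gaplie z x) + gaplie z (gaplie x y).

Let jac_rot x y z : jac x y z = jac y z x.
Proof. by rewrite /jac -addrA [LHS]addrC. Qed.

Let jac_ind y z : (forall b, jac (gapgen K b) y z = 0) -> forall x, jac x y z = 0.
Proof.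
move=> jb; apply: gapvir_ind => // [|a x x' hx hx'].
  by rewrite /jac !(gaplie0l, gaplie0r) !addr0.
rewrite /jac !(gaplie_linearl, gaplie_linearr) lin3 -!/(jac _ _ _) hx hx'.
by rewrite scaler0 addr0.
Qed.

Lemma gaplieC x c : gaplie x (gapgen K (bC c)) = 0.
Proof.
move: x; apply: gapvir_ind => [|a x y hx hy|b]; first by rewrite gaplie0l.
  by rewrite gaplie_linearl hx hy scaler0 addr0.
by rewrite gaplieU; case: b.
Qed.

Lemma gaplieCl x c : gaplie (gapgen K (bC c)) x = 0.
Proof. by have := gaplie_anti (gapgen K (bC c)) x; rewrite gaplieC addr0. Qed.

Let jacC c x y : jac (gapgen K (bC c)) x y = 0.
Proof. by rewrite /jac !(gaplieC, gaplieCl, gaplie0r) !addr0. Qed.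

Lemma gaplieLL m n : gaplie (Lgen m) (Lgen n) = (m - n)%:~R *: Lgen (m + n)
  + ((m ^+ 3 - m)%:~R / 12%:R * (m + n == 0)%:R) *: C0gen.
Proof. exact: gaplieU. Qed.

Lemma gaplieLI m n i :
  gaplie (Lgen m) (Igen n i) = - (n%:~R + i%:R / p%:R) *: Igen (m + n) i.
Proof. exact: gaplieU. Qed.

Lemma gaplieIL m n i :
  gaplie (Igen n i) (Lgen m) = (n%:~R + i%:R / p%:R) *: Igen (m + n) i.
Proof. exact: gaplieU. Qed.

Lemma gaplieII m n i j : gaplie (Igen m i) (Igen n j) =
  ((m%:~R + i%:R / p%:R) * (i + j == p)%N%:R * (m + n + 1 == 0)%:R) *: Cgen i.
Proof. exact: gaplieU. Qed.

Let gaplieC0 x : gaplie x C0gen = 0. Proof. exact: gaplieC. Qed.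
Let gaplieCi x i : gaplie x (Cgen i) = 0. Proof. exact: gaplieC. Qed.

Let jacLLL a b c : jac (Lgen a) (Lgen b) (Lgen c) = 0.
Proof.
have step x y z : gaplie (Lgen x) (gaplie (Lgen y) (Lgen z)) =
    ((y - z)%:~R * (x - (y + z))%:~R) *: Lgen (x + (y + z)) +
    ((y - z)%:~R * ((x ^+ 3 - x)%:~R / 12%:R * (x + (y + z) == 0)%:R))
      *: C0gen.
  rewrite (gaplieLL y z) gaplieDr !gaplieZr gaplieC0 scaler0 addr0 gaplieLL.
  by rewrite scalerDr !scalerA.
rewrite /jac !step.
have -> : b + (c + a) = a + (b + c) by ring.
have -> : c + (a + b) = a + (b + c) by ring.
apply: scale33; first by ring.
case: eqP => [abc|_]; last by rewrite /= mulr0n !mulr0 !addr0.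
by have -> : c = - a - b by [lia]; field.
Qed.

Let jacLLI a b c i : jac (Lgen a) (Lgen b) (Igen c i) = 0.
Proof.
rewrite /jac (gaplieLI b) (gaplieIL a) (gaplieLL a b) !gaplieZr gaplieDr !gaplieZr gaplieC0.
rewrite scaler0 addr0 !gaplieLI gaplieIL !scalerA.
have -> : b + (a + c) = a + (b + c) by ring.
have -> : a + b + c = a + (b + c) by ring.
by apply: scale3; ring.
Qed.

Let jacLII a b c i j : jac (Lgen a) (Igen b i) (Igen c j) = 0.
Proof.
rewrite /jac (gaplieLI a) (gaplieIL a) (gaplieII b c) !gaplieZr gaplieCi scaler0 add0r.
rewrite !gaplieII !scalerA [(j + i)%N]addnC.
case: (boolP (i + j == p)%N) => [ij|_]; last first.
  by apply: zero2; rewrite /= mulr0n mulr0 mul0r mulr0.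
rewrite (Cgen_sym ij); apply: scale2; rewrite (gapidx_ratN ij).
have -> : c + (a + b) = b + (a + c) by ring.
case: eqP => [abc|_]; last by rewrite /= mulr0n !mulr0 addr0.
by have -> : c = - a - b - 1 by [lia]; ring.
Qed.

Let jacIII a b c i j k : jac (Igen a i) (Igen b j) (Igen c k) = 0.
Proof. by rewrite /jac !gaplieII !gaplieZr !gaplieCi !scaler0 !addr0. Qed.

Lemma gaplie_jacobi x y z :
  gaplie x (gaplie y z) + gaplie y (gaplie z x) + gaplie z (gaplie x y) = 0.
Proof.
rewrite -/(jac x y z); move: x; apply: jac_ind => a; rewrite jac_rot.
move: y; apply: jac_ind => b; rewrite jac_rot.
move: z; apply: jac_ind => c; rewrite jac_rot.
case: a => [m|m i|d]; last exact: jacC.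
- case: b => [n|n j|d]; last by rewrite jac_rot; exact: jacC.
  + case: c => [k|k l|d]; last by rewrite 2!jac_rot; exact: jacC.
    * exact: jacLLL.
    * exact: jacLLI.
  + case: c => [k|k l|d]; last by rewrite 2!jac_rot; exact: jacC.
    * by rewrite 2!jac_rot; exact: jacLLI.
    * exact: jacLII.
- case: b => [n|n j|d]; last by rewrite jac_rot; exact: jacC.
  + case: c => [k|k l|d]; last by rewrite 2!jac_rot; exact: jacC.
    * by rewrite jac_rot; exact: jacLLI.
    * by rewrite jac_rot; exact: jacLII.
  + case: c => [k|k l|d]; last by rewrite 2!jac_rot; exact: jacC.
    * by rewrite 2!jac_rot; exact: jacLII.
    * exact: jacIII.
Qed.

HB.instance Definition _ := isLieAlgebra.Build K (gapvir K p)
  gaplie_linearl gaplie_linearr gaplie_alt gaplie_jacobi.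

End GapVirasoroLie.

Section Subalgebras.
Context (K : numFieldType) (p : nat).
Notation g := (gapvir K p).
Notation Lgen := (@Lgen K p).
Notation Igen := (@Igen K p).
Notation C0gen := (@C0gen K p).
Notation Cgen := (@Cgen K p).

Lemma lieC0 (x : g) : lie x C0gen = 0.
Proof. exact: gaplieC. Qed.
Lemma lieCi (x : g) i : lie x (Cgen i) = 0.
Proof. exact: gaplieC. Qed.
Lemma lieC0l (x : g) : lie C0gen x = 0.
Proof. exact: gaplieCl. Qed.
Lemma lieCil (x : g) i : lie (Cgen i) x = 0.
Proof. exact: gaplieCl. Qed.

Definition heis_plus_gens (I : {set gapidx p}) : set g :=
  [set x | exists i, i \in I /\ ((exists n : nat, x = Igen n i) \/ x = Cgen i)].

Definition gap_pos_gens (m : nat) : set g :=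
  [set x | [\/ exists k : nat, x = Lgen (m + k)%N,
               exists (k : nat) (i : gapidx p), x = Igen k i,
               x = C0gen | exists i : gapidx p, x = Cgen i]].

Let lspan0 (S : set g) : lspan S 0.
Proof. exact: (lspan_subspace S).1. Qed.

Let lspanZ (S : set g) a x : lspan S x -> lspan S (a *: x).
Proof.
by move=> Sx; rewrite -[_ *: _]addr0; apply: (lspan_subspace S).2.
Qed.

Let lspanD (S : set g) x y : lspan S x -> lspan S y -> lspan S (x + y).
Proof.
by move=> Sx Sy; rewrite -[x]scale1r; apply: (lspan_subspace S).2.
Qed.

Lemma heis_plus_gens_lie I x y : heis_plus_gens I x -> heis_plus_gens I y ->
  lspan (heis_plus_gens I) (lie x y).
Proof.
move=> [i [_ [[m ->]|->]]]; last by rewrite lieCil.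
move=> [j [_ [[n ->]|->]]]; last by rewrite lieCi.
suff -> : lie (Igen m i) (Igen n j) = 0 by [].
rewrite [lie _ _]gaplieII; have -> : (m%:Z + n%:Z + 1 == 0) = false by lia.
by rewrite /= mulr0n mulr0 scale0r.
Qed.

Lemma gap_pos_gens_lie m x y : gap_pos_gens m x -> gap_pos_gens m y ->
  lspan (gap_pos_gens m) (lie x y).
Proof.
have SC0 : lspan (gap_pos_gens m) C0gen.
  by apply: sub_gen_smallest; apply: Or43.
have SC i : lspan (gap_pos_gens m) (Cgen i).
  by apply: sub_gen_smallest; apply: Or44; exists i.
have SL n : (m%:Z <= n) -> lspan (gap_pos_gens m) (Lgen n).
  case: n => n // mn; apply: sub_gen_smallest; apply: Or41.
  by exists (n - m)%N; rewrite subnKC.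
have SI (n : int) i : (0 <= n) -> lspan (gap_pos_gens m) (Igen n i).
  case: n => n // mn; apply: sub_gen_smallest; apply: Or42.
  by exists n, i.
move=> [[k ->]|[k [i ->]]|->|[i ->]]; last 2 first.
- by rewrite lieC0l.
- by rewrite lieCil.
- move=> [[l ->]|[l [j ->]]|->|[j ->]]; rewrite ?lieC0 ?lieCi//.
  + rewrite [lie _ _]gaplieLL; apply: lspanD; apply: lspanZ => //.
    by apply: SL; lia.
  + by rewrite [lie _ _]gaplieLI; apply: lspanZ; apply: SI; lia.
- move=> [[l ->]|[l [j ->]]|->|[j ->]]; rewrite ?lieC0 ?lieCi//.
  + by rewrite [lie _ _]gaplieIL; apply: lspanZ; apply: SI; lia.
  + by rewrite [lie _ _]gaplieII; apply: lspanZ.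
Qed.

(* h_I^+ *)
Definition heis_plus (I : {set gapidx p}) : lie_subalgebra g :=
  span_subalgebra (@heis_plus_gens_lie I).

(* g^(m) *)
Definition gap_pos (m : nat) : lie_subalgebra g :=
  span_subalgebra (@gap_pos_gens_lie m).

Variables (m : nat) (I : {set gapidx p}) (phi : g -> K).

(* The central index 0 is never of the form [centridx i] when 1 < p.  Since the
   function is only meant on g^(m), it is set to 0 on the remaining basis
   elements L_n (n < m) and I_n (n < 0). *)
Definition whittaker_ext_basis (b : gapbasis p) : K^o :=
  match b with
  | bL n =>
      if (m%:Z <= n) && (n <= (2 * m)%N%:Z) then
        \sum_(j in I) (2 * phi (Cgen j))^-1 *
          \sum_(k < m) phi (Igen k j) * phi (Igen (n - k%:Z - 1) (gapidx_opp j))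
      else 0
  | bI n i => if (0 <= n) && (i \in I) then phi (Igen n i) else 0
  | bC c =>
      if c == ord0 then #|I|%:R
      else if [exists i in I, centridx i == c] then phi (gapgen K (bC c))
      else 0
  end.

(* phi^e *)
Definition whittaker_ext (x : g) : K := lin_ext whittaker_ext_basis x.

Lemma whittaker_ext_gen b : whittaker_ext (gapgen K b) = whittaker_ext_basis b.
Proof. by rewrite /whittaker_ext gapgen.unlock lin_extU. Qed.

Lemma centridx_neq0 (i : gapidx p) : centridx i != ord0.
Proof.
have := gapidx_gt0 i; have := gapidx_lt i => ip i0.
by rewrite -val_eqE /= /centridx inordK; case: ifP; lia.
Qed.

Lemma whittaker_extC i : symmetrical I ->
  whittaker_ext (Cgen i) = if i \in I then phi (Cgen i) else 0.
Proof.
move=> symI; rewrite whittaker_ext_gen /= (negPf (centridx_neq0 i)).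
suff -> : [exists j in I, centridx j == centridx i] = (i \in I) by [].
apply/existsP/idP => [[j /andP[jI /eqP/(congr1 val)]]|iI]; last first.
  by exists i; rewrite iI eqxx.
have := gapidx_lt i; have := gapidx_lt j => jp ip.
have := gapidx_gt0 i; have := gapidx_gt0 j => j0 i0.
rewrite /= /centridx !inordK; do ?[by case: ifP; lia] => e.
have [ij|ij] : gapidx_nat i = gapidx_nat j \/ gapidx_nat i = (p - gapidx_nat j)%N.
- by move: e; do 2![case: ifP]; lia.
- by rewrite (_ : i = j) //; apply/val_inj/val_inj.
- by rewrite (_ : i = gapidx_opp j) ?symI//; apply/val_inj/val_inj.
Qed.

Lemma whittaker_ext_extends x : symmetrical I ->
  whittaker_function (heis_plus I) phi ->
  heis_plus I x -> whittaker_ext x = phi x.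
Proof.
move=> symI [phiD _] hx; suff [] : heis_plus I x /\ whittaker_ext x = phi x by [].
have [h0 hD] := subalg_subspace (heis_plus I).
have e0 : whittaker_ext 0 = 0.
  by rewrite /whittaker_ext lin_extE msupp0 big_seq_fset0.
have p0 : phi 0 = 0.
  have := phiD 1 0 0 h0 h0; rewrite scale1r mul1r addr0 => /eqP.
  by rewrite -subr_eq subrr eq_sym => /eqP.
move: x hx; apply: smallest_sub; first split.
- by rewrite e0 p0.
- move=> a u v [hu eu] [hv ev]; split; first exact: hD.
  by rewrite phiD // -eu -ev /whittaker_ext lin_ext_linear.
move=> x Sx; split; first exact: sub_gen_smallest.
case: Sx => i [iI [[n ->]|->]].
- by rewrite whittaker_ext_gen /= iI.
- by rewrite whittaker_extC // iI.
Qed.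

End Subalgebras.

(* The pairs (n, i) with n >= 1 and i in I, indexing the variables t_{n,i}. *)
Definition tvar (p : nat) (I : {set gapidx p}) : Type :=
  {v : nat * gapidx p | (0 < v.1)%N && (v.2 \in I)}.
HB.instance Definition _ p (I : {set gapidx p}) := Choice.on (tvar I).

Notation tvar_deg v := (val v).1.
Notation tvar_idx v := (val v).2.

Notation polyring K X := {malg K[{cmonom X}]}.

Section PartialDerivative.
Context (K : numFieldType) (X : choiceType).

Definition pvar (v : X) : polyring K X := << ucm v >>.

Definition pderiv (v : X) : polyring K X -> polyring K X :=
  lin_ext (fun mu : cmonom X => (mu v)%:R *: << divcm mu (ucm v) >>).

Lemma pderiv_linear v : linear (pderiv v).
Proof. exact: lin_ext_linear. Qed.

Lemma pderivU v mu : pderiv v << mu >> = (mu v)%:R *: << divcm mu (ucm v) >>.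
Proof. exact: lin_extU. Qed.

Lemma pderiv_var v w : pderiv v (pvar w) = (w == v)%:R.
Proof.
rewrite pderivU ucmE; case: eqVneq => [->|_]; last by rewrite scale0r.
rewrite scale1r; suff -> : divcm (ucm v) (ucm v) = mone by [].
by apply/eqP/cmP => i; rewrite divcmE cm1 subnn.
Qed.

Let zero_scale (V : lmodType K) (x y : V) : 0%:R *: x = 0%:R *: y.
Proof. by rewrite mulr0n !scale0r. Qed.

Let leibniz_mono (A : comAlgType K) (D : A -> A) (c d : K) (x y z t u w : A) :
  x * y = z -> D z = (c + d) *: t -> D x = c *: u -> D y = d *: w ->
  c *: t = c *: (u * y) -> d *: t = d *: (x * w) ->
  D (x * y) = D x * y + x * D y.
Proof.
by move=> -> -> -> -> ct dt; rewrite scalerDl ct dt scalerAl scalerAr.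
Qed.

Let stepl (A : comAlgType K) (D : A -> A) (linD : linear D) a f f' g :
  D (f * g) = D f * g + f * D g -> D (f' * g) = D f' * g + f' * D g ->
  D ((a *: f + f') * g) = D (a *: f + f') * g + (a *: f + f') * D g.
Proof.
move=> hf hf'; rewrite mulrDl -scalerAl !linD hf hf' !mulrDl -!scalerAl.
by rewrite scalerDr addrACA.
Qed.

Lemma pderivM v f g : pderiv v (f * g) = pderiv v f * g + f * pderiv v g.
Proof.
have p0 : pderiv v 0 = 0 by rewrite /pderiv lin_extE msupp0 big_seq_fset0.
move: f; apply: malg_ind => [|a f f' hf hf'|mu].
- by rewrite !(mul0r, p0) addr0.
- exact: (@stepl (polyring K X : comAlgType K) _ (@pderiv_linear v) a _ _ _ hf hf').
rewrite mulrC [RHS]addrC [X in _ = X + _]mulrC [X in _ = _ + X]mulrC.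
move: g; apply: malg_ind => [|a f f' hf hf'|nu].
- by rewrite !(mul0r, p0) addr0.
- exact: (@stepl (polyring K X : comAlgType K) _ (@pderiv_linear v) a _ _ _ hf hf').
have mm (a b : cmonom X) : << a >> * << b >> = << mmul a b >> :> polyring K X.
  by rewrite malgM_def fgmulUU mulr1.
have key (a b : cmonom X) : (a v)%:R *: << divcm (mmul a b) (ucm v) >> =
    (a v)%:R *: (<< divcm a (ucm v) >> * << b >>) :> polyring K X.
  have [->|av0] := eqVneq (a v) 0%N; first exact: zero_scale.
  suff -> : divcm (mmul a b) (ucm v) = mmul (divcm a (ucm v)) b by rewrite mm.
  apply/eqP/cmP => i; rewrite cmM !divcmE cmM ucmE.
  by case: eqVneq => [<-|_]; lia.
apply: (@leibniz_mono (polyring K X : comAlgType K) _ (nu v)%:R (mu v)%:R _ _ _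
  _ _ _ (mm nu mu) _ (pderivU v nu) (pderivU v mu) (key nu mu)).
- by rewrite -natrD -cmM; exact: pderivU.
- by rewrite mulmC [X in _ = _ *: X]mulrC; exact: key.
Qed.

End PartialDerivative.

Section NormalOrdering.
Context (K : numFieldType) (p : nat) (V : lmodType K).

(* :I_k^{(i)} I_l^{(p-i)}: *)
Definition normal_ordered (A : lie_module (gapvir K p) V) (i : gapidx p)
    (k l : int) (f : V) : V :=
  if k < l then A (Igen K k i) (A (Igen K l (gapidx_opp i)) f)
  else A (Igen K l (gapidx_opp i)) (A (Igen K k i) f).

End NormalOrdering.

(* Main.v *)
Require Import Defs.
From HB Require Import structures.
From mathcomp Require Import all_boot all_order all_algebra finmap.
From mathcomp Require Import monalg.
From mathcomp Require Import boolp classical_sets cardinality fsbigop reals.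
From mathcomp Require Import complex ring zify.

(** For [i] in [I], the operators prescribed for the [I_n^(i)], written [H_n^(i)] below, are
    multiplications by a variable for [n < 0] and a multiple of a partial
    derivative plus a constant for [n >= 0].  Since [[d/dt, t] = 1], they
    satisfy the Heisenberg relations
    [[H_m^(i), H_n^(j)] = (m + i/p) delta_{i+j,p} delta_{m+n+1,0} l_i]
    ([fock_swap]), and since a polynomial involves finitely many variables and
    [phi(I_n^(i)) = 0] for [n >= m], every polynomial is killed by all [H_n^(i)]
    with [n] large ([fock_smooth]).

    These two properties alone carry the Sugawara construction, which is done
    over an arbitrary vector space.  Smoothness makes each normally ordered sum
    [S_n^(j) = sum_k :H_k^(j) H_{n-k-1}^(p-j):] finite on every vector.  As a
    normally ordered product differs from the plain one by a scalar,
    commuting [H_r^(i)] through it leaves at most two terms of the sum, so that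
    [L_n = sum_j S_n^(j) / (2 l_j) + const] satisfies
    [[L_n, H_r^(i)] = - (r + i/p) H_{n+r}^(i)] ([sugawara_swap]).  Hence [L_m]
    acts on each summand of [S_n^(j)] as a derivation ([sugawara_nord]);
    reindexing one half of the result by [k -> m + k] gives
    [(m - n) S_{m+n}^(j)].  The products so obtained are no longer normally
    ordered, and reordering them costs scalars whose sum over [k] is, for
    [m = - n >= 0], the finite sum of [(k + a) (m - k - a)] over [0 <= k < m] with
    [a = j/p].  It equals [(m^3 - m) / 6 + m a (1 - a)]
    ([virasoro_cocycle_sumE]): the cubic part is the Virasoro cocycle with
    central charge 1 for each [j], and the linear part is absorbed by the
    constant [j (p - j) / (4 p^2) = a (1 - a) / 4] added to [L_0].

    Every submodule is stable under multiplication by the variables and under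
    the partial derivatives, because the scalars [l_i (n - i/p)] are nonzero.
    Differentiating a nonzero polynomial enough times yields a nonzero
    constant, and multiplying [1] by variables yields everything: the module is
    irreducible, and generated by any nonzero vector.  Finally [1] is a
    Whittaker vector: for [n >= m], a term of [L_n 1] survives only if both of
    its factors have an index between [0] and [m - 1], where they act on [1] by
    the values of [phi], which is the formula defining [phi^e(L_n)].  That
    [phi^e] vanishes on brackets follows, since it is the eigenvalue of a common
    eigenvector. *)

Set Implicit Arguments.
Unset Strict Implicit.
Unset Printing Implicit Defensive.

Import Order.TTheory GRing.Theory Num.Theory.
Local Open Scope classical_set_scope.
Local Open Scope ring_scope.

(** * Linear maps and subspaces *)

Section LinearProp.
Context (K : pzRingType) (U V : lmodType K) (D : U -> V).

Lemma linear_prop0 : linear D -> D 0 = 0.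
Proof. by move=> /(_ (-1) 0 0); rewrite scaler0 addr0 scaleN1r addNr. Qed.

Lemma linear_propZ a u : linear D -> D (a *: u) = a *: D u.
Proof.
by move=> linD; rewrite -[a *: u]addr0 linD (linear_prop0 linD) addr0.
Qed.

End LinearProp.

Lemma subspaceZ (K : fieldType) (V : lmodType K) (W : set V) :
  is_subspace W -> forall a u, W u -> W (a *: u).
Proof. by move=> [W0 WD] a u Wu; rewrite -[a *: u]addr0; exact: WD. Qed.

Lemma subspace_affine (K : fieldType) (V : lmodType K) (W : set V) (c d : K) g h :
  is_subspace W -> c != 0 -> W g -> W (c *: h + d *: g) -> W h.
Proof.
move=> subW c0 Wg Wh; have WZ := @subspaceZ _ _ _ subW.
suff -> : h = c^-1 *: (- d *: g + (c *: h + d *: g)) by apply/WZ/subW.2.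
by rewrite addrC -addrA -scalerDl addrN scale0r addr0 scalerA mulVf// scale1r.
Qed.

(** * Finitely supported sums *)

Section FiniteSupportSums.
Context (T : choiceType) (V W : zmodType).
Implicit Types F G : T -> V.

Lemma fsumTD F G : finite_set [set k | F k != 0] ->
    finite_set [set k | G k != 0] ->
  \sum_(k \in [set: T]) (F k + G k) =
  \sum_(k \in [set: T]) F k + \sum_(k \in [set: T]) G k.
Proof.
move=> finF finG.
pose A := fset_set ([set k | F k != 0] `|` [set k | G k != 0]).
have outA k : k \notin A -> F k = 0 /\ G k = 0.
  rewrite in_fset_set ?finite_setU// notin_setE/= => /not_orP[].
  by move=> /negP/negbNE/eqP-> /negP/negbNE/eqP->.
rewrite !(@fsbigTE _ _ _ _ A) ?big_split// => k /outA[]//.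
by move=> -> ->; rewrite addr0.
Qed.

Lemma raddf_fsumT (u : {additive V -> W}) F : finite_set [set k | F k != 0] ->
  u (\sum_(k \in [set: T]) F k) = \sum_(k \in [set: T]) u (F k).
Proof.
move=> finF; have outA k : k \notin fset_set [set k | F k != 0] -> F k = 0.
  by rewrite in_fset_set// notin_setE/= => /negP/negbNE/eqP.
rewrite !(@fsbigTE _ _ _ _ (fset_set [set k | F k != 0])) ?raddf_sum// => k.
by move=> /outA->; rewrite raddf0.
Qed.

Lemma finite_suppD F G : finite_set [set k | F k != 0] ->
  finite_set [set k | G k != 0] -> finite_set [set k | F k + G k != 0].
Proof.
move=> finF finG; have finFG : finite_set ([set k | F k != 0] `|` [set k | G k != 0]).
  by rewrite finite_setU.
apply: sub_finite_set finFG => k /= FGk.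
have [Fk|] := eqVneq (F k) 0; last by left.
by right; apply: contraNneq FGk => Gk; rewrite Fk Gk addr0.
Qed.

Lemma finite_supp_raddf (u : {additive V -> W}) F :
  finite_set [set k | F k != 0] -> finite_set [set k | u (F k) != 0].
Proof.
apply: sub_finite_set => k /=; apply: contraNneq => Fk.
by rewrite Fk raddf0.
Qed.

Lemma fsumT_delta k0 F : (forall k, k != k0 -> F k = 0) ->
  \sum_(k \in [set: T]) F k = F k0.
Proof.
move=> F0; rewrite (@fsbigTE _ _ _ _ [fset k0]%fset) ?big_seq_fset1// => k.
by rewrite in_fset1; exact: F0.
Qed.

End FiniteSupportSums.

Section IntegerWindows.
Implicit Types (a : int) (n : nat).

Let window a n : seq int := [seq a + i%:Z | i <- iota 0 n].

Let mem_window a n k : a <= k -> k < a + n%:Z -> k \in window a n.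
Proof.
move=> ak kn; apply/mapP; exists `|k - a|%N; last by lia.
by rewrite mem_iota; lia.
Qed.

Lemma finite_set_window a n (D : set int) :
  (forall k, D k -> a <= k < a + n%:Z) -> finite_set D.
Proof.
move=> Dan; apply: (@sub_finite_set _ _ [set` window a n]); last first.
  exact: finite_seq.
by move=> k /Dan /andP[ak kn]; rewrite /= mem_window.
Qed.

Lemma fsum_window (V : zmodType) a n (F : int -> V) :
  (forall k, ~~ (a <= k < a + n%:Z) -> F k = 0) ->
  \sum_(k \in [set: int]) F k = \sum_(i < n) F (a + i%:Z).
Proof.
move=> Fan; rewrite (fsbigE (window a n))//.
- rewrite (eq_bigl xpredT) => [|k]; last by rewrite in_setT.
  by rewrite big_map -(big_mkord xpredT (fun i => F (a + i%:Z))) /index_iota subn0.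
- by rewrite map_inj_uniq ?iota_uniq// => i j /addrI[].
move=> k _ kw; apply: Fan; apply: contra kw => /andP[].
exact: mem_window.
Qed.

Lemma fsum_shift (V : zmodType) a (F : int -> V) :
  \sum_(k \in [set: int]) F (a + k) = \sum_(k \in [set: int]) F k.
Proof.
rewrite [RHS](@reindex_fsbigT _ _ _ _ _ (fun k => a + k))//.
by exists (fun k => k - a) => k; ring.
Qed.

End IntegerWindows.

(** * The Sugawara construction *)

(** Operators [H n i] on a vector space [V] that satisfy the Heisenberg relations
    at levels [ell i] and are smooth: each vector is killed by all [H n i] with
    [n] large.  They are given for all [i], and vanish outside [I], so that the
    relations need no side condition. *)
Section Sugawara.
Context (K : numFieldType) (p : nat) (V : lmodType K) (I : {set gapidx p}).
Context (ell : gapidx p -> K) (H : int -> gapidx p -> {linear V -> V}).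
Implicit Types (i j : gapidx p) (k l m n r : int) (f : V).

(** The degree of [H n i]: the bracket with [L_0] multiplies [I_n^(i)] by
    [- (n + i / p)]. *)
Definition mode n i : K := n%:~R + i%:R / p%:R.

Definition heis_cocycle m i n j : K :=
  mode m i * (i + j == p)%N%:R * (m + n + 1 == 0)%:R * ell i.

Context (I_sym : symmetrical I).
Context (ell_sym : forall i, ell (gapidx_opp i) = ell i).
Context (ell_neq0 : forall i, i \in I -> ell i != 0).
Context (H_out : forall n i f, i \notin I -> H n i f = 0).
Context (H_swap : forall m i n j f,
  H m i (H n j f) = H n j (H m i f) + heis_cocycle m i n j *: f).
Context (H_smooth : forall f, exists N : nat, forall n i, N%:Z <= n -> H n i f = 0).

Lemma gapidx_oppK : involutive (@gapidx_opp p).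
Proof.
by move=> i; apply/val_inj/val_inj => /=; rewrite subKn// ltnW// gapidx_lt.
Qed.

Lemma gapidx_opp_add i j : (i + j == p)%N = (i == gapidx_opp j).
Proof.
have := gapidx_lt i; have := gapidx_lt j => jp ip.
apply/eqP/eqP => [ij|->]; last by rewrite /= subnK// ltnW.
have e : gapidx_nat i = (p - gapidx_nat j)%N by lia.
exact/val_inj/val_inj.
Qed.

Lemma mode_opp n i : mode (- n - 1) (gapidx_opp i) = - mode n i.
Proof.
have ii : (i + gapidx_opp i == p)%N by rewrite gapidx_opp_add gapidx_oppK.
by rewrite /mode (gapidx_ratN K ii); ring.
Qed.

Lemma heis_cocycle_diag r i j :
  heis_cocycle (- r - 1) j r i = (j == gapidx_opp i)%:R * (- mode r i * ell i).
Proof.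
rewrite /heis_cocycle gapidx_opp_add.
have -> : (- r - 1 + r + 1 == 0) = true by lia.
case: eqVneq => [->|_]; last by rewrite /= !mulr0n mulr0 !mul0r.
by rewrite mode_opp ell_sym !mulr1 mul1r.
Qed.

Lemma heis_cocycle_eq0 r i k j : k != - r - 1 -> heis_cocycle k j r i = 0.
Proof.
move=> kr; rewrite /heis_cocycle; have -> : (k + r + 1 == 0) = false by lia.
by rewrite mulr0n mulr0 mul0r.
Qed.

(** The normally ordered product [:H_k^(j) H_l^(p-j):]. *)
Definition nord j k l f : V :=
  if k < l then H k j (H l (gapidx_opp j) f) else H l (gapidx_opp j) (H k j f).

Lemma nord_is_linear j k l : linear (nord j k l).
Proof. by move=> a f g; rewrite /nord; case: ifP => _; rewrite !linearP. Qed.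

HB.instance Definition _ j k l :=
  GRing.isLinear.Build K V V *:%R (nord j k l) (nord_is_linear j k l).

Lemma nord_heis j k l f : H k j (H l (gapidx_opp j) f) =
  nord j k l f + ((l <= k)%R%:R * heis_cocycle k j l (gapidx_opp j)) *: f.
Proof.
rewrite /nord; case: ltP => _; first by rewrite mul0r scale0r addr0.
by rewrite mul1r H_swap.
Qed.

(** Both orders of the product give the same commutator with [H r i], since the
    two brackets involved are scalars. *)
Lemma nord_swap j k l r i f : nord j k l (H r i f) = H r i (nord j k l f) +
  (heis_cocycle l (gapidx_opp j) r i *: H k j f
   + heis_cocycle k j r i *: H l (gapidx_opp j) f).
Proof.
rewrite /nord; case: ifP => _.
  by rewrite [H l _ _]H_swap linearD linearZ [in LHS]H_swap -addrA [X in _ + X]addrC.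
by rewrite [H k j (H r i f)]H_swap linearD linearZ [in LHS]H_swap -addrA.
Qed.

(** The factor acting first is the one with the larger index, so smoothness
    kills the product as soon as one of the indices is large; when [k + l] is
    fixed, this leaves finitely many [k]. *)
Lemma nord_eq0 f : exists N : nat, forall j k l,
  (N%:Z <= k) || (N%:Z <= l) -> nord j k l f = 0.
Proof.
have [N HN] := H_smooth f; exists N => j k l Nkl; rewrite /nord; case: ltP => kl.
  by rewrite [H l _ f]HN ?linear0//; lia.
by rewrite [H k _ f]HN ?linear0//; lia.
Qed.

Lemma nord_finite j a n f : finite_set [set k | nord j (a + k) (n - k - 1) f != 0].
Proof.
have [N HN] := nord_eq0 f.
apply: (@finite_set_window (n - N%:Z) `|(N%:Z + N%:Z - a - n)%R|%N) => k /= nz.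
rewrite leNgt; apply: contraNT nz => kN; rewrite HN//; lia.
Qed.

(** The [n]-th mode of the normally ordered product of the fields of index [j]
    and [p - j]. *)
Definition quad j n f : V := \sum_(k \in [set: int]) nord j k (n - k - 1) f.

Lemma nord_quad_finite j n f : finite_set [set k | nord j k (n - k - 1) f != 0].
Proof.
by have := nord_finite j 0 n f; under eq_set do rewrite add0r.
Qed.

Lemma quad_is_linear j n : linear (quad j n).
Proof.
move=> a f g; rewrite /quad; under eq_fsbigr do rewrite linearP.
have fin := nord_quad_finite j n.
have finZ := finite_supp_raddf (GRing.scale a) (fin f).
rewrite (fsumTD finZ (fin g)).
by congr (_ + _); rewrite [RHS](raddf_fsumT (GRing.scale a) (fin f)).
Qed.

HB.instance Definition _ j n :=
  GRing.isLinear.Build K V V *:%R (quad j n) (quad_is_linear j n).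

(** Only [k = n + r] and [k = - r - 1] contribute, through the second and the
    first factor respectively. *)
Lemma quad_swap j n r i f : quad j n (H r i f) = H r i (quad j n f)
  + (- mode r i * ell j * ((j == i)%:R + (j == gapidx_opp i)%:R))
    *: H (n + r) i f.
Proof.
rewrite /quad (raddf_fsumT (H r i) (nord_quad_finite j n f)).
under eq_fsbigr do rewrite nord_swap.
have fin1 : finite_set [set k : int | heis_cocycle (n - k - 1) (gapidx_opp j) r i
    *: H k j f != 0].
  apply: (@finite_set_window (n + r) 1) => k /= nz.
  suff -> : k = n + r by lia.
  apply: contraNeq nz => kr; rewrite heis_cocycle_eq0 ?scale0r//.
  by apply: contra kr => /eqP; lia.
have fin2 : finite_set [set k : int | heis_cocycle k j r i
    *: H (n - k - 1) (gapidx_opp j) f != 0].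
  apply: (@finite_set_window (- r - 1) 1) => k /= nz.
  suff -> : k = - r - 1 by lia.
  by apply: contraNeq nz => kr; rewrite heis_cocycle_eq0 ?scale0r.
rewrite fsumTD; [|exact: finite_supp_raddf (nord_quad_finite j n f)|]; last first.
  exact: finite_suppD fin1 fin2.
congr (_ + _); rewrite fsumTD// (fsumT_delta (k0 := n + r)) => [|k kr]; last first.
  by rewrite heis_cocycle_eq0 ?scale0r//; apply: contra kr => /eqP; lia.
rewrite (fsumT_delta (k0 := - r - 1)) => [|k kr]; last first.
  by rewrite heis_cocycle_eq0 ?scale0r.
have -> : n - (n + r) - 1 = - r - 1 by ring.
have -> : n - (- r - 1) - 1 = n + r by ring.
rewrite !heis_cocycle_diag (inv_eq gapidx_oppK) gapidx_oppK.
rewrite mulrDr scalerDl; congr (_ + _).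
  by case: eqVneq => [->|_]; rewrite ?mul1r ?mulr1// mul0r mulr0 !scale0r.
by case: eqVneq => [->|_]; rewrite ?gapidx_oppK ?ell_sym ?mul1r ?mulr1//
  mul0r mulr0 !scale0r.
Qed.

(** The constant added to [L_0], the sum of the [a (1 - a) / 4] for [a = j / p];
    it cancels the linear part of [virasoro_cocycle_sumE]. *)
Definition vacuum_weight : K :=
  \sum_(j in I) (gapidx_nat j)%:R * (p - gapidx_nat j)%N%:R / (4 * p%:R ^+ 2).

Definition sugawara n f : V :=
  \sum_(j in I) (2 * ell j)^-1 *: quad j n f
  + ((n == 0)%:R * vacuum_weight) *: f.

(** Lets the levels and the inner sums be given by other expressions, such as
    those of a formula stated on a module. *)
Lemma sugawara_eq (c : gapidx p -> K) (q : gapidx p -> V) n f :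
    (forall j, j \in I -> c j = ell j) -> (forall j, j \in I -> q j = quad j n f) ->
  sugawara n f = \sum_(j in I) (2 * c j)^-1 *: q j
                 + ((n == 0)%:R * vacuum_weight) *: f.
Proof.
move=> cE qE; congr (_ + _).
by apply: eq_bigr => j jI; rewrite cE// qE.
Qed.

Lemma sugawara_is_linear n : linear (sugawara n).
Proof.
move=> a f g; rewrite /sugawara [in RHS]scalerDr scaler_sumr [RHS]addrACA -big_split/=.
congr (_ + _); last by rewrite linearP.
by apply: eq_bigr => j _; rewrite linearP scalerDr !scalerA [_ * a]mulrC.
Qed.

HB.instance Definition _ n :=
  GRing.isLinear.Build K V V *:%R (sugawara n) (sugawara_is_linear n).

(** Each of the indices [j = i] and [j = p - i] contributes one half, and when
    [i = p - i] the only index contributes twice. *)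
Lemma sugawara_swap n r i f :
  sugawara n (H r i f) = H r i (sugawara n f) + - mode r i *: H (n + r) i f.
Proof.
have [iI|iI] := boolP (i \in I); last by rewrite !H_out// linear0 scaler0 addr0.
rewrite /sugawara linearD linearZ linear_sum/= [RHS]addrAC; congr (_ + _).
under [in RHS]eq_bigr => j _ do rewrite linearZ/=.
under eq_bigr => j _ do rewrite quad_swap scalerDr scalerA.
rewrite big_split/=; congr (_ + _); rewrite -scaler_suml; congr (_ *: _).
transitivity (- mode r i / 2 * (\sum_(j in I) (j == i)%:R
                             + \sum_(j in I) (j == gapidx_opp i)%:R)).
  rewrite -big_split mulr_sumr; apply: eq_bigr => j jI /=.
  by have := ell_neq0 jI => lj; field.
have delta i0 : i0 \in I -> \sum_(j in I) (j == i0)%:R = 1 :> K.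
  move=> i0I; rewrite (bigD1 i0)//= eqxx big1 ?addr0// => j /andP[_ ji].
  by rewrite (negPf ji).
by rewrite !delta ?I_sym//; field.
Qed.

Lemma sugawara_swap2 m k i l j f : sugawara m (H k i (H l j f)) =
  H k i (H l j (sugawara m f)) + - mode k i *: H (m + k) i (H l j f)
  + - mode l j *: H k i (H (m + l) j f).
Proof.
by rewrite !sugawara_swap linearD linearZ/= addrAC.
Qed.

(** [sugawara m] acts as a derivation on plain products; normal ordering of
    the two results costs the scalars on the last two lines. *)
Lemma sugawara_nord m j k l f : sugawara m (nord j k l f) =
  nord j k l (sugawara m f) + - mode k j *: nord j (m + k) l f
  + - mode l (gapidx_opp j) *: nord j k (m + l) f
  + (- mode k j * ((l <= m + k)%R%:R * heis_cocycle (m + k) j l (gapidx_opp j))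
     - mode l (gapidx_opp j) *
       ((m + l <= k)%R%:R * heis_cocycle k j (m + l) (gapidx_opp j))) *: f.
Proof.
have e g : nord j k l g = H k j (H l (gapidx_opp j) g)
    - ((l <= k)%R%:R * heis_cocycle k j l (gapidx_opp j)) *: g.
  by rewrite nord_heis addrK.
rewrite !e linearB linearZ/= sugawara_swap2.
rewrite [H (m + k) j _]nord_heis [X in _ + _ *: X - _]nord_heis.
by rewrite !scalerDr !scalerA scalerDl !addrA [LHS](ACl (1*6*2*4*3*5))/= !mulNr.
Qed.

(** The scalars of [sugawara_nord] for [k + l = - m - 1], up to the level,
    summed over all [k]; the difference of indicators makes the sum finite. *)
Definition virasoro_cocycle_sum m i : K := \sum_(k \in [set: int])
  mode k i * mode (m + k) i * ((0 <= k)%R%:R - (0 <= m + k)%R%:R).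

(** Reindexing [:H_{m+k} H_{n-k-1}:] by [k -> k - m] matches it with
    [:H_k H_{m+n-k-1}:], and the coefficients
    [- (k - m + a)] and [- (n - k - a)] add up to [m - n]. *)
Lemma sugawara_quad m j n f : sugawara m (quad j n f) =
  quad j n (sugawara m f) + (m - n)%:~R *: quad j (m + n) f
  + ((m + n == 0)%:R * (ell j * virasoro_cocycle_sum m j)) *: f.
Proof.
have fin := nord_quad_finite j n.
(* the scalars of sugawara_nord, and their common form t up to the level *)
pose s k : K := - mode k j * ((n - k - 1 <= m + k)%R%:R
      * heis_cocycle (m + k) j (n - k - 1) (gapidx_opp j))
  - mode (n - k - 1) (gapidx_opp j) * ((m + (n - k - 1) <= k)%R%:R
      * heis_cocycle k j (m + (n - k - 1)) (gapidx_opp j)).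
pose t k : K := mode k j * mode (m + k) j * ((0 <= k)%R%:R - (0 <= m + k)%R%:R).
have st k : s k = (m + n == 0)%:R * (ell j * t k).
  rewrite /s /t /heis_cocycle gapidx_opp_add gapidx_oppK eqxx.
  have -> : (m + k + (n - k - 1) + 1 == 0) = (m + n == 0) by lia.
  have -> : (k + (m + (n - k - 1)) + 1 == 0) = (m + n == 0) by lia.
  case: eqP => [mn|_]; last by rewrite !mulr0n; ring.
  have -> : (n - k - 1 <= m + k) = (0 <= m + k) by lia.
  have -> : (m + (n - k - 1) <= k) = (0 <= k) by lia.
  have -> : n - k - 1 = - (m + k) - 1 by lia.
  by rewrite mode_opp /= !mulr1n; ring.
have fint : finite_set [set k : int | t k != 0].
  apply: (@finite_set_window (- `|m|) (2 * `|m|)%N) => k /=.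
  apply: contraNT => km; rewrite /t.
  suff -> : (0 <= m + k) = (0 <= k) by rewrite subrr mulr0.
  by lia.
have fins (g : V) : finite_set [set k : int | s k *: g != 0].
  apply: sub_finite_set fint => k /=; apply: contraNneq => tk.
  by rewrite st tk !mulr0 scale0r.
have finB : finite_set [set k : int |
    - mode k j *: nord j (m + k) (n - k - 1) f != 0].
  apply: sub_finite_set (nord_finite j m n f) => k /=.
  by apply: contraNneq => ->; rewrite scaler0.
have eC k : m + (n - k - 1) = m + n - k - 1 by ring.
have finC : finite_set [set k : int |
    - mode (n - k - 1) (gapidx_opp j) *: nord j k (m + (n - k - 1)) f != 0].
  apply: sub_finite_set (nord_quad_finite j (m + n) f) => k /=; rewrite eC.
  by apply: contraNneq => ->; rewrite scaler0.
rewrite [LHS](raddf_fsumT (sugawara m) (fin f))/=.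
under eq_fsbigr do rewrite sugawara_nord -/(s _).
have finAB := finite_suppD (fin (sugawara m f)) finB.
rewrite (fsumTD (finite_suppD finAB finC) (fins f)) (fsumTD finAB finC).
rewrite (fsumTD (fin _) finB); congr (_ + _); last first.
  have outt k : k \notin fset_set [set k | t k != 0] -> t k = 0.
    by rewrite in_fset_set// notin_setE/= => /negP/negbNE/eqP.
  rewrite /virasoro_cocycle_sum !(@fsbigTE _ _ _ _ (fset_set [set k | t k != 0]))//.
    by rewrite !mulr_sumr scaler_suml; apply: eq_bigr => k _; rewrite st.
  by move=> k /outt tk; rewrite st tk !mulr0 scale0r.
rewrite -addrA; congr (_ + _).
pose G k := - mode (k - m) j *: nord j k (m + n - k - 1) f.
rewrite [X in X + _](_ : _ = \sum_(k \in [set: int]) G (m + k)); last first.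
  apply: eq_fsbigr => k _; rewrite /G; congr (- mode _ _ *: nord _ _ _ _); ring.
rewrite fsum_shift -fsumTD//; last first.
  apply: sub_finite_set (nord_quad_finite j (m + n) f) => k /=.
  by apply: contraNneq => Gk; rewrite /G Gk scaler0.
rewrite [RHS](raddf_fsumT (GRing.scale (m - n)%:~R) (nord_quad_finite j (m + n) f)).
apply: eq_fsbigr => k _; rewrite /G eC -scalerDl; congr (_ *: _).
have -> : n - k - 1 = - (k - n) - 1 by ring.
by rewrite mode_opp /mode; ring.
Qed.

(** For [m >= 0] the indicators select [- m <= k < 0]; shifting by [m] turns the
    summand into [(k + a) (m - k - a)] with [0 <= k < m], a sum of squares.
    For [m < 0] they select [0 <= k < - m], which gives the opposite of the
    sum for [- m]. *)
Lemma virasoro_cocycle_sumE m i (a := i%:R / p%:R : K) :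
  virasoro_cocycle_sum m i = (m ^+ 3 - m)%:~R / 6 + m%:~R * (a * (1 - a)).
Proof.
(* the upper bound n is kept apart from q so that induction applies *)
have sumE (q c : K) (n : nat) : \sum_(k < n) (k%:R + c) * (q - k%:R - c) =
    n%:R * c * (q - c) + (q - 2 * c) * (n%:R * (n%:R - 1) / 2)
    - n%:R * (n%:R - 1) * (2 * n%:R - 1) / 6.
  elim: n => [|n IHn]; first by rewrite big_ord0; ring.
  by rewrite big_ord_recr/= IHn -natr1; field.
have [n nm] : exists n : nat, m = n%:Z \/ m = - n%:Z by exists `|m|%N; lia.
rewrite /virasoro_cocycle_sum /mode -/a; case: nm => -> {m}.
  rewrite (@fsum_window _ (- n%:Z) n); last first.
    move=> k kn; suff -> : (0 <= n%:Z + k) = (0 <= k) by rewrite subrr mulr0.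
    by lia.
  transitivity (\sum_(k < n) (k%:R + a) * (n%:R - k%:R - a)).
    apply: eq_bigr => k _.
    have -> : (0 <= - n%:Z + k%:Z) = false by have := ltn_ord k; lia.
    have -> : n%:Z + (- n%:Z + k%:Z) = k%:Z by ring.
    by rewrite intrD mulrNz /= mulr1n mulr0n; ring.
  by rewrite sumE -pmulrn; field.
rewrite (@fsum_window _ 0 n); last first.
  move=> k kn; suff -> : (0 <= - n%:Z + k) = (0 <= k) by rewrite subrr mulr0.
  by lia.
transitivity (- \sum_(k < n) (k%:R + a) * (n%:R - k%:R - a)).
  rewrite -sumrN; apply: eq_bigr => k _; rewrite add0r.
  have -> : (0 <= - n%:Z + k%:Z) = false by have := ltn_ord k; lia.
  by rewrite intrD mulrNz /= mulr1n mulr0n; ring.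
by rewrite sumE; field.
Qed.

(** The Virasoro relation, of central charge [#|I|].  Divided by [2 l_j], the
    scalar of [sugawara_quad] is [(m^3 - m) / 12 + m a (1 - a) / 2] for
    [m + n = 0]; the second term is the contribution of [j] to [2 m] times
    [vacuum_weight]. *)
Lemma sugawara_comm m n f : sugawara m (sugawara n f) =
  sugawara n (sugawara m f) + (m - n)%:~R *: sugawara (m + n) f
  + ((m ^+ 3 - m)%:~R / 12%:R * (m + n == 0)%:R * #|I|%:R) *: f.
Proof.
have scalar : \sum_(j in I) (2 * ell j)^-1 *
      ((m + n == 0)%:R * (ell j * virasoro_cocycle_sum m j)) =
    (m - n)%:~R * ((m + n == 0)%:R * vacuum_weight)
    + (m ^+ 3 - m)%:~R / 12%:R * (m + n == 0)%:R * #|I|%:R.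
  case: eqP => [mn|_]; last first.
    by rewrite big1 => [|j _]; rewrite mulr0n ?(mul0r, mulr0) ?addr0.
  have -> : n = - m by lia.
  rewrite /vacuum_weight !mul1r mulr1 -sumr_const !mulr_sumr -big_split/=.
  apply: eq_bigr => j jI; rewrite virasoro_cocycle_sumE natrB; last first.
    exact/ltnW/gapidx_lt.
  have lj := ell_neq0 jI; have p0 : p%:R != 0 :> K.
    by rewrite pnatr_eq0; have := gapidx_lt j; lia.
  by field; rewrite p0 lj.
have E g k : sugawara k g = \sum_(j in I) (2 * ell j)^-1 *: quad j k g
  + ((k == 0)%:R * vacuum_weight) *: g by [].
rewrite [X in sugawara m X]E linearD linearZ linear_sum/=.
rewrite [sugawara (m + n) f]E [sugawara n _]E.
under eq_bigr => j _ do rewrite linearZ/= sugawara_quad !scalerDr.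
move: (sugawara m f) => g; rewrite !big_split/=.
have -> : \sum_(j in I) (2 * ell j)^-1 *: ((m - n)%:~R *: quad j (m + n) f) =
    (m - n)%:~R *: \sum_(j in I) (2 * ell j)^-1 *: quad j (m + n) f.
  by rewrite scaler_sumr; apply: eq_bigr => j _; rewrite !scalerA mulrC.
under [X in _ + _ + X + _]eq_bigr do rewrite scalerA.
rewrite -scaler_suml scalar scalerDl -scalerA.
by rewrite scalerDr !addrA [LHS](ACl (1*5*2*3*4)).
Qed.

End Sugawara.

(** * Partial derivatives of polynomials *)

Section PartialDerivatives.
Context (K : numFieldType) (X : choiceType).
Implicit Types (v w : X) (mu nu : cmonom X) (f g : polyring K X).

HB.instance Definition _ v := GRing.isLinear.Build K (polyring K X)
  (polyring K X) *:%R (@pderiv K X v) (@pderiv_linear K X v).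

Lemma mcoeff_pderiv v f mu :
  (pderiv v f)@_mu = (mu v).+1%:R * f@_(mmul mu (ucm v)).
Proof.
move: f; apply: malg_ind => [|a f g hf hg|nu].
- by rewrite linear0 !mcoeff0 mulr0.
- by rewrite linearP !mcoeffD !mcoeffZ hf hg; ring.
rewrite pderivU mcoeffZ !mcoeffU1.
have [->|ne] := eqVneq nu (mmul mu (ucm v)).
  suff -> : divcm (mmul mu (ucm v)) (ucm v) = mu.
    by rewrite eqxx cmM cmUU addn1.
  by apply/eqP/cmP => w; rewrite divcmE cmM addnK.
have [->|nuv] := eqVneq (nu v) 0%N; first by rewrite mul0r mulr0.
rewrite [_ == mu](_ : _ = false) ?mulr0//; apply: contraNF ne => /eqP <-.
by apply/cmP => w; rewrite cmM divcmE ucmE; case: eqVneq => [<-|_]; lia.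
Qed.

Lemma pderivC v w f : pderiv v (pderiv w f) = pderiv w (pderiv v f).
Proof.
apply/malgP => mu; have [->//|vw] := eqVneq v w.
rewrite [LHS]mcoeff_pderiv [RHS]mcoeff_pderiv.
rewrite (mcoeff_pderiv w f) (mcoeff_pderiv v f).
have -> : mmul (mmul mu (ucm w)) (ucm v) = mmul (mmul mu (ucm v)) (ucm w).
  by apply/eqP/cmP => x; rewrite !cmM addnAC.
rewrite !cmM !ucmE [w == v]eq_sym (negPf vw) !addn0.
exact: mulrCA.
Qed.

Lemma pderiv_pvarM v w f :
  pderiv v (pvar K w * f) = pvar K w * pderiv v f + (w == v)%:R *: f.
Proof.
rewrite pderivM pderiv_var [LHS]addrC; congr (_ + _).
case: (w == v); first by rewrite [LHS]mul1r [RHS]scale1r.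
by rewrite [LHS]mul0r [RHS]scale0r.
Qed.

(** [f] involves finitely many variables, hence [d] is bounded on them. *)
Lemma pderiv_finite (d : X -> nat) f :
  exists N : nat, forall v, (N <= d v)%N -> pderiv v f = 0.
Proof.
move: f; apply: malg_ind => [|a f g [N HN] [M HM]|mu].
- by exists 0%N => v _; rewrite linear0.
- exists (maxn N M) => v; rewrite geq_max => /andP[Nv Mv].
  by rewrite pderiv_linear HN// HM// scaler0 addr0.
exists (\max_(v <- finsupp mu) d v).+1 => v vN; rewrite pderivU.
have [->|muv] := eqVneq (mu v) 0%N; first by rewrite scale0r.
have vmu : v \in finsupp mu by rewrite -cmE_neq0.
have := @leq_bigmax_seq _ _ xpredT d v vmu isT.
by move=> /leq_ltn_trans /(_ vN); rewrite ltnn.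
Qed.

Lemma mul_pvarU v mu : pvar K v * << mu >> = << mmul (ucm v) mu >>.
Proof. by rewrite /pvar malgM_def fgmulUU mulr1. Qed.

Lemma cmonom_factor mu : mu != mone ->
  exists v nu, mu = mmul (ucm v) nu /\ mdeg mu = (mdeg nu).+1.
Proof.
move=> mu1; have [v vmu] : exists v, v \in finsupp mu.
  apply/fset0Pn; apply: contra mu1 => /eqP mu0.
  by apply/cmP => v; rewrite cm1; apply/eqP; rewrite cmE_eq0 mu0 inE.
have e : mu = mmul (ucm v) (divcm mu (ucm v)).
  apply/eqP/cmP => w; rewrite cmM divcmE ucmE.
  by move: vmu; rewrite -cmE_neq0; case: (eqVneq v w) => [<-|_]; lia.
by exists v, (divcm mu (ucm v)); split; rewrite // {1}e mdegM mdegU add1n.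
Qed.

(** Differentiating with respect to a variable that occurs lowers the degree;
    the process stops at a nonzero constant. *)
Lemma invariant_pderiv_1 (W : set (polyring K X)) : is_subspace W ->
    (forall v f, W f -> W (pderiv v f)) ->
  forall f, f != 0 -> W f -> W 1.
Proof.
move=> subW Wd f; have WZ := @subspaceZ _ _ _ subW.
have [d df] : exists d : nat, forall mu, f@_mu != 0 -> (mdeg mu <= d)%N.
  exists (msize f) => mu; rewrite mcoeff_neq0 => /msize_mdeg_lt.
  exact: ltnW.
elim: d f df => [|d IHd] f df f0 Wf.
  suff <- : (f@_mone)^-1 *: f = 1 by exact: WZ.
  have fE mu : mu != mone -> f@_mu = 0.
    move=> mu1; apply: contraNeq mu1 => /df; rewrite leqn0 mdeg_eq0.
    by [].
  have f1 : f@_mone != 0.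
    apply: contraNneq f0 => f1; apply/eqP/malgP => mu; rewrite mcoeff0.
    by have [->//|/fE] := eqVneq mu mone.
  apply/malgP => mu; rewrite mcoeffZ mcoeff1.
  by have [->|/fE->] := eqVneq mu mone; rewrite ?mulVf// mulr0.
(* if all derivatives vanish, f is constant and the bound d applies to it *)
have [f1|] := pselect (forall v, pderiv v f = 0).
  apply: (IHd f) => // mu fmu.
  have [->|mu1] := eqVneq mu mone; first by rewrite mdeg1.
  have [v [nu [e _]]] := cmonom_factor mu1.
  have /malgP/(_ nu) := f1 v; rewrite mcoeff_pderiv mcoeff0 mulmC -e => /eqP.
  by rewrite mulf_eq0 pnatr_eq0 (negPf fmu).
move=> /existsNP[v /eqP dvf]; apply: (IHd (pderiv v f)) => //; last exact: Wd.
move=> mu; rewrite mcoeff_pderiv mulf_eq0 negb_or => /andP[_ /df].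
by rewrite mdegM mdegU addn1.
Qed.

Lemma invariant_pvar_full (W : set (polyring K X)) : is_subspace W ->
    (forall v f, W f -> W (pvar K v * f)) -> W 1 -> W = [set: polyring K X].
Proof.
move=> [W0 WD] Wv W1; apply/seteqP; split=> // f _; move: f.
suff Wmu d mu : (mdeg mu < d)%N -> W << mu >>.
  by apply: (malg_ind W0 WD) => mu; apply: Wmu (ltnSn _).
elim: d mu => [mu dmu|d IHd mu dmu].
  by exfalso; move: dmu; rewrite ltn0.
have [->//|mu1] := eqVneq mu mone.
have [v [nu [e de]]] := cmonom_factor mu1.
by rewrite e -mul_pvarU; apply/Wv/IHd; rewrite -ltnS -de.
Qed.

End PartialDerivatives.

(** * Heisenberg operators on the polynomial ring *)

(** Operators of the form [c D + d]: the [H_n^(i)] with [n >= 0] are of this form,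
    with [D] a partial derivative and [d] a value of [phi]. *)
Lemma linear_affine (K : comPzRingType) (V : lmodType K) (D : V -> V) (c d : K) :
  linear D -> linear (fun f => c *: D f + d *: f).
Proof.
move=> linD a f g; rewrite linD !scalerDr !scalerA [c * a]mulrC [d * a]mulrC.
exact: addrACA.
Qed.

Lemma linear_mull (K : fieldType) (A : comAlgType K) (x : A) :
  linear (fun f => x * f).
Proof. by move=> a f g; rewrite mulrDr scalerAr. Qed.

Lemma affine_comm (K : comPzRingType) (V : lmodType K) (D E : V -> V)
    (c d c' d' : K) f : linear D -> linear E -> (forall g, D (E g) = E (D g)) ->
  c *: D (c' *: E f + d' *: f) + d *: (c' *: E f + d' *: f) =
  c' *: E (c *: D f + d *: f) + d' *: (c *: D f + d *: f).
Proof.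
move=> linD linE DE.
have DZ g h (a b : K) : D (a *: g + b *: h) = a *: D g + b *: D h.
  by rewrite linD linear_propZ.
have EZ g h (a b : K) : E (a *: g + b *: h) = a *: E g + b *: E h.
  by rewrite linE linear_propZ.
rewrite DZ EZ DE !scalerDr !scalerA [c' * c]mulrC [c' * d]mulrC [d' * c]mulrC.
by rewrite [d' * d]mulrC addrACA.
Qed.

Lemma affine_mul_swap (K : fieldType) (A : comAlgType K) (D : A -> A) (x : A)
    (c d e : K) f : D (x * f) = x * D f + e *: f ->
  c *: D (x * f) + d *: (x * f) = x * (c *: D f + d *: f) + (c * e) *: f.
Proof.
by move=> ->; rewrite scalerDr mulrDr -!scalerAr scalerA addrAC.
Qed.

Section FockOperators.
Context (K : numFieldType) (p : nat) (I : {set gapidx p}).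
Context (ell : gapidx p -> K) (psi : int -> gapidx p -> K).
Implicit Types (i j : gapidx p) (n : int).
Notation P := (polyring K (tvar I)).
Implicit Types (f g : P) (v w : tvar I).

Definition fock_annihilation (v : tvar I) (c d : K) (f : P) : P :=
  c *: pderiv v f + d *: f.

Definition fock_creation (v : tvar I) (f : P) : P := pvar K v * f.

(** The operator of [I_n^(i)].  The index [n = k >= 0] corresponds to the
    variable [t_{k+1,p-i}] and [n = - (k + 1)] to [t_{k+1,i}]; [insub] fails
    exactly when [i] is not in the symmetrical set [I]. *)
Definition fock n i : P -> P :=
  match n with
  | Posz k => if insub (k.+1, gapidx_opp i) is Some v
              then fock_annihilation v (ell i * mode K k i) (psi k i)
              else fun=> 0
  | Negz k => if insub (k.+1, i) is Some v then fock_creation v else fun=> 0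
  end.

Lemma fock_annihilation_linear v c d : linear (fock_annihilation v c d).
Proof. exact/linear_affine/pderiv_linear. Qed.

Lemma fock_creation_linear v : linear (fock_creation v).
Proof. exact: linear_mull. Qed.

Lemma fock_linear n i : linear (fock n i).
Proof.
have lin0 : linear (fun _ : P => 0 : P) by move=> a f g; rewrite scaler0 addr0.
case: n => n; rewrite /fock; case: insub => [v|//].
  exact: fock_annihilation_linear.
exact: fock_creation_linear.
Qed.

HB.instance Definition _ n i := GRing.isLinear.Build K P P *:%R (fock n i)
  (@fock_linear n i).

Context (I_sym : symmetrical I).
Context (ell_sym : forall i, ell (gapidx_opp i) = ell i).
Context (ell_out : forall i, i \notin I -> ell i = 0).
Context (psi_large : exists m : nat, forall (n : nat) i,
  i \in I -> (m <= n)%N -> psi n i = 0).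

Lemma heis_cocycle_anti m i n j :
  heis_cocycle ell n j m i = - heis_cocycle ell m i n j.
Proof.
rewrite /heis_cocycle gapidx_opp_add [(i + j)%N]addnC gapidx_opp_add.
case: eqVneq => [->|_]; last by rewrite mulr0n !mulr0 !mul0r oppr0.
rewrite [n + m]addrC; case: eqP => [mn|_]; last by rewrite mulr0n !mulr0 !mul0r oppr0.
have -> : n = - m - 1 by lia.
by rewrite mode_opp ell_sym; ring.
Qed.

Lemma gapidx_opp_in i : (gapidx_opp i \in I) = (i \in I).
Proof. by apply/idP/idP => /I_sym //; rewrite gapidx_oppK. Qed.

Lemma fock_posz (k : nat) i : i \in I -> exists2 v : tvar I,
  val v = (k.+1, gapidx_opp i) &
  fock k i = fock_annihilation v (ell i * mode K k i) (psi k i).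
Proof.
move=> iI; rewrite /fock; case: insubP => [v _ vE|]; first by exists v.
by rewrite /= gapidx_opp_in iI.
Qed.

Lemma fock_negz (k : nat) i : i \in I ->
  exists2 v : tvar I, val v = (k.+1, i) & fock (Negz k) i = fock_creation v.
Proof.
move=> iI; rewrite /fock; case: insubP => [v _ vE|]; first by exists v.
by rewrite /= iI.
Qed.

Lemma fock_out n i f : i \notin I -> fock n i f = 0.
Proof.
move=> iI; rewrite /fock; case: n => n.
  by rewrite insubF//= gapidx_opp_in (negPf iI).
by rewrite insubF//= (negPf iI).
Qed.

Lemma fock_smooth f : exists N : nat, forall n i, N%:Z <= n -> fock n i f = 0.
Proof.
have [M HM] := psi_large; have [N HN] := pderiv_finite (fun v : tvar I => tvar_deg v) f.
exists (maxn M N) => -[n|//] i Nn.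
have [iI|iI] := boolP (i \in I); last exact: fock_out.
have [v vE ->] := fock_posz n iI.
rewrite /fock_annihilation HN ?vE/=; last by lia.
rewrite HM//; last by lia.
by rewrite scale0r scaler0 addr0.
Qed.

(** The Heisenberg relations.  Only a creation and an annihilation operator fail
    to commute, and they do so when they involve the same variable. *)
Lemma fock_swap m i n j f :
  fock m i (fock n j f) = fock n j (fock m i f) + heis_cocycle ell m i n j *: f.
Proof.
have [iI|iI] := boolP (i \in I); last first.
  rewrite !(fun n f => @fock_out n i f iI) linear0 add0r /heis_cocycle ell_out//.
  by rewrite mulr0 scale0r.
have [jI|jI] := boolP (j \in I); last first.
  rewrite !(fun n f => @fock_out n j f jI) linear0 add0r.
  rewrite /heis_cocycle gapidx_opp_add [i == _](_ : _ = false).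
    by rewrite mulr0n mulr0 !mul0r scale0r.
  by apply: contraNF jI => /eqP ij; rewrite -gapidx_opp_in -ij.
have mixed (a b : nat) i' j' : i' \in I -> j' \in I ->
    fock (Posz a) i' (fock (Negz b) j' f) =
    fock (Negz b) j' (fock (Posz a) i' f) + heis_cocycle ell a i' (Negz b) j' *: f.
  move=> iI' jI'; have [v vE ->] := fock_posz a iI'.
  have [w wE ->] := fock_negz b jI'.
  have -> : heis_cocycle ell a i' (Negz b) j' = ell i' * mode K a i' * (w == v)%:R.
    have -> : (w == v) = (b.+1 == a.+1)%N && (j' == gapidx_opp i').
      by rewrite -[LHS]val_eqE wE vE xpair_eqE.
    rewrite /heis_cocycle gapidx_opp_add [j' == _]eq_sym.
    rewrite -[gapidx_opp i' == j'](inj_eq (can_inj (@gapidx_oppK p))) gapidx_oppK.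
    have -> : (a%:Z + Negz b + 1 == 0) = (b.+1 == a.+1)%N by lia.
    by rewrite -[RHS]mulrA andbC -mulnb natrM; ring.
  exact: (@affine_mul_swap _ (P : comAlgType K) _ _ _ _ _ _ (pderiv_pvarM v w f)).
case: m n => [a|a] [b|b].
- have -> : heis_cocycle ell (Posz a) i (Posz b) j = 0.
    rewrite /heis_cocycle; have -> : (a%:Z + b%:Z + 1 == 0) = false by lia.
    by rewrite mulr0n mulr0 mul0r.
  rewrite scale0r addr0; have [v _ ->] := fock_posz a iI.
  have [w _ ->] := fock_posz b jI.
  apply: affine_comm; [exact: pderiv_linear|exact: pderiv_linear|].
  exact: pderivC.
- exact: mixed.
- by rewrite (mixed b a j i jI iI) heis_cocycle_anti scaleNr subrK.
- have -> : heis_cocycle ell (Negz a) i (Negz b) j = 0.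
    rewrite /heis_cocycle; have -> : (Negz a + Negz b + 1 == 0) = false by lia.
    by rewrite mulr0n mulr0 mul0r.
  rewrite scale0r addr0; have [v _ ->] := fock_negz a iI.
  by have [w _ ->] := fock_negz b jI; exact: mulrCA.
Qed.

End FockOperators.

(** * Modules over the gap-p Virasoro algebra *)

Section LieModuleEigenvectors.
Context (K : fieldType) (L : lieAlgType K) (V : lmodType K) (A : lie_module L V).

(** The operators [A x], [x] in [S], act on [v] by scalars, hence commute on it. *)
Lemma eigenvector_lie (S : lie_subalgebra L) (chi : L -> K) v : v != 0 ->
    (forall x, S x -> A x v = chi x *: v) ->
  forall x y, S x -> S y -> chi (lie x y) = 0.
Proof.
move=> v0 Av x y Sx Sy; have := Av _ (subalg_lie Sx Sy).
rewrite act_lie !Av// !(linear_propZ _ _ (act_linearr A _)) !Av// !scalerA.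
rewrite [chi y * _]mulrC subrr => /esym/eqP.
by rewrite scaler_eq0 (negPf v0) orbF => /eqP.
Qed.

End LieModuleEigenvectors.

(** A module is given by operators for the basis elements that satisfy the
    bracket relations of the basis. *)
Section GapModule.
Context (K : numFieldType) (p : nat) (V : lmodType K).
Context (T : gapbasis p -> V -> V) (T_linear : forall b, linear (T b)).

Definition gap_act (x : gapvir K p) (f : V) : V := lin_ext (T^~ f) x.

Lemma gap_act_gen b f : gap_act (gapgen K b) f = T b f.
Proof. by rewrite /gap_act gapgen.unlock lin_extU. Qed.

Lemma gap_act_linearl f : linear (gap_act^~ f).
Proof. exact: lin_ext_linear. Qed.

Lemma gap_act_linearr x : linear (gap_act x).
Proof.
move=> a f g; rewrite /gap_act !lin_extE scaler_sumr -big_split/=.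
apply: eq_bigr => b _; rewrite T_linear scalerDr !scalerA [_ * a]mulrC.
by [].
Qed.

Context (T_lie : forall a b f,
  gap_act (gapbr K a b) f = T a (T b f) - T b (T a f)).

Lemma gap_act_lie x y f : gap_act (lie x y) f =
  gap_act x (gap_act y f) - gap_act y (gap_act x f).
Proof.
have act0 g : gap_act 0 g = 0 := linear_prop0 (gap_act_linearl g).
have act0r z : gap_act z 0 = 0 := linear_prop0 (gap_act_linearr z).
move: x; apply: gapvir_ind => [|a x x' hx hx'|b].
- by rewrite [lie _ _]gaplie0l !act0 act0r subr0.
- rewrite lie_linearl !gap_act_linearl hx hx' gap_act_linearr.
  by rewrite scalerBr opprD addrACA.
move: y; apply: gapvir_ind => [|a y y' hy hy'|c].
- by rewrite [lie _ _]gaplie0r !act0 act0r subr0.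
- rewrite lie_linearr !gap_act_linearl hy hy' gap_act_linearr.
  by rewrite scalerBr opprD addrACA.
by rewrite [lie _ _]gaplieU T_lie !gap_act_gen.
Qed.

Definition gap_module : lie_module (gapvir K p) V :=
  LieModule gap_act_linearl gap_act_linearr gap_act_lie.

End GapModule.

Section SugawaraModule.
Context (K : numFieldType) (p : nat) (V : lmodType K) (I : {set gapidx p}).
Context (ell : gapidx p -> K) (H : int -> gapidx p -> {linear V -> V}).
Context (charge : 'I_p./2.+1 -> K).
Context (I_sym : symmetrical I).
Context (ell_sym : forall i, ell (gapidx_opp i) = ell i).
Context (ell_neq0 : forall i, i \in I -> ell i != 0).
Context (H_out : forall n i f, i \notin I -> H n i f = 0).
Context (H_swap : forall m i n j f,
  H m i (H n j f) = H n j (H m i f) + heis_cocycle ell m i n j *: f).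
Context (H_smooth : forall f, exists N : nat, forall n i, N%:Z <= n -> H n i f = 0).
Context (charge0 : charge ord0 = #|I|%:R).
Context (chargeE : forall i, charge (centridx i) = ell i).

Definition sugawara_op (b : gapbasis p) (f : V) : V :=
  match b with
  | bL n => sugawara I ell H n f
  | bI n i => H n i f
  | bC c => charge c *: f
  end.

Lemma sugawara_op_linear b : linear (sugawara_op b).
Proof.
case: b => [n|n i|c] a f g /=; last by rewrite scalerDr !scalerA mulrC.
  by rewrite sugawara_is_linear.
exact: linearP.
Qed.

Lemma sugawara_op_lie a b f : gap_act sugawara_op (gapbr K a b) f =
  sugawara_op a (sugawara_op b f) - sugawara_op b (sugawara_op a f).
Proof.
have act0 : gap_act sugawara_op (0 : gapvir K p) f = 0.
  exact: linear_prop0 (gap_act_linearl _ f).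
have actZ x c : gap_act sugawara_op (c *: (x : gapvir K p)) f =
    c *: gap_act sugawara_op x f.
  exact: linear_propZ (gap_act_linearl _ f).
have linZ d c g : sugawara_op d (c *: g) = c *: sugawara_op d g.
  exact: linear_propZ (sugawara_op_linear d).
have central c d : sugawara_op d (sugawara_op (bC c) f) =
    sugawara_op (bC c) (sugawara_op d f).
  exact: linZ.
have centralP c d : 0 = sugawara_op d (sugawara_op (bC c) f) -
    sugawara_op (bC c) (sugawara_op d f) by rewrite central subrr.
have centralPl c d : 0 = sugawara_op (bC c) (sugawara_op d f) -
    sugawara_op d (sugawara_op (bC c) f) by rewrite central subrr.
case: a b => [m|m i|c] [n|n j|d];
  try by [rewrite [LHS]act0; exact: centralP | rewrite [LHS]act0; exact: centralPl].
- rewrite [gapbr _ _ _]/gapbr gap_act_linearl actZ /Lgen /C0gen !gap_act_gen /= charge0.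
  rewrite sugawara_comm// scalerA [RHS]addrAC [X in _ = X + _]addrAC subrr.
  by rewrite add0r.
- rewrite /gapbr actZ gap_act_gen /= sugawara_swap// /mode.
  by rewrite [RHS]addrAC subrr add0r.
- rewrite /gapbr actZ gap_act_gen /= sugawara_swap// /mode.
  by rewrite opprD addrA subrr sub0r scaleNr opprK.
rewrite /gapbr actZ gap_act_gen /= chargeE H_swap scalerA.
by rewrite [RHS]addrAC subrr add0r.
Qed.

Definition sugawara_module : lie_module (gapvir K p) V :=
  gap_module sugawara_op_linear sugawara_op_lie.

End SugawaraModule.

(** * Whittaker vectors of the Sugawara operators *)

(** A vector on which the [H n i] with [n >= 0] act by scalars that vanish for
    [n >= m]. *)
Section WhittakerVector.
Context (K : numFieldType) (p : nat) (V : lmodType K) (I : {set gapidx p}).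
Context (ell : gapidx p -> K) (H : int -> gapidx p -> {linear V -> V}).
Context (psi : int -> gapidx p -> K) (m : nat) (u : V).
Context (I_sym : symmetrical I).
Context (H_u : forall (n : nat) i, i \in I -> H n i u = psi n i *: u).
Context (psi_large : forall (n : nat) i, i \in I -> (m <= n)%N -> psi n i = 0).

Lemma H_u0 (n : int) i : i \in I -> m%:Z <= n -> H n i u = 0.
Proof.
by case: n => n // iI mn; rewrite H_u// psi_large ?scale0r.
Qed.

(** A term with [k < 0] or [k >= m] has a factor of index at least [m], which
    normal ordering lets act first. *)
Lemma quad_whittaker (n : nat) j : j \in I -> (m <= n)%N -> quad H j n u =
  (\sum_(k < m) psi k j * psi (n%:Z - k%:Z - 1) (gapidx_opp j)) *: u.
Proof.
move=> jI mn; rewrite /quad (@fsum_window _ 0 m) => [|k km].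
  rewrite scaler_suml; apply: eq_bigr => k _; rewrite add0r.
  have -> : n%:Z - k%:Z - 1 = (n - k - 1)%N%:Z by have := ltn_ord k; lia.
  rewrite /nord; case: ifP => _.
    by rewrite H_u ?I_sym// linearZ/= H_u// scalerA mulrC.
  by rewrite H_u// linearZ/= H_u ?I_sym// scalerA.
rewrite /nord; case: ltP => kl.
  by rewrite [H _ (gapidx_opp j) u]H_u0 ?I_sym ?linear0//; lia.
by rewrite [H k j u]H_u0 ?linear0//; lia.
Qed.

(** For [n > 2 m] and [k < m] the index [n - k - 1] is at least [m], so that all
    the products vanish. *)
Lemma sugawara_whittaker (n : nat) : (0 < m)%N -> (m <= n)%N ->
  sugawara I ell H n u =
  (if (n <= 2 * m)%N then \sum_(j in I) (2 * ell j)^-1 *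
     \sum_(k < m) psi k j * psi (n%:Z - k%:Z - 1) (gapidx_opp j)
   else 0) *: u.
Proof.
move=> m0 mn; rewrite /sugawara; have -> : (n%:Z == 0) = false by lia.
rewrite mul0r scale0r addr0.
under eq_bigr => j jI do rewrite quad_whittaker// scalerA.
rewrite -scaler_suml; case: leqP => // nm; congr (_ *: _).
apply: big1 => j jI; rewrite big1 ?mulr0// => k _.
have -> : n%:Z - k%:Z - 1 = (n - k - 1)%N%:Z by have := ltn_ord k; lia.
by rewrite [psi (n - k - 1)%N _]psi_large ?mulr0 ?I_sym//; have := ltn_ord k; lia.
Qed.

End WhittakerVector.

(** * The polynomial module *)

Section FockModule.
Context (K : numFieldType) (p m : nat) (I : {set gapidx p}).
Context (phi : gapvir K p -> K).
Implicit Types (i j : gapidx p) (v : tvar I).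
Notation P := (polyring K (tvar I)).
Context (I_sym : symmetrical I).
Context (phi_central : forall i, i \in I -> phi (Cgen K i) != 0).
Context (phi_large : forall (n : nat) i,
  i \in I -> (m <= n)%N -> phi (Igen K n i) = 0).

(** [l_i], extended by 0 outside [I] so that the Heisenberg relations hold for
    all indices. *)
Definition level i : K := if i \in I then phi (Cgen K i) else 0.

Lemma Cgen_opp i : Cgen K (gapidx_opp i) = Cgen K i.
Proof. by apply: Cgen_sym; rewrite gapidx_opp_add gapidx_oppK. Qed.

Lemma level_opp i : level (gapidx_opp i) = level i.
Proof. by rewrite /level gapidx_opp_in// Cgen_opp. Qed.

Lemma level_neq0 i : i \in I -> level i != 0.
Proof. by move=> iI; rewrite /level iI phi_central. Qed.

Lemma level_out i : i \notin I -> level i = 0.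
Proof. by rewrite /level => /negPf->. Qed.

Definition mode_op n i : {linear P -> P} :=
  fock level (fun n i => phi (Igen K n i)) n i.

Lemma mode_opE n i f :
  mode_op n i f = fock level (fun n i => phi (Igen K n i)) n i f.
Proof. by []. Qed.

(** The central elements act by the values of [phi^e], so that they satisfy the
    Whittaker condition on every vector. *)
Definition charge (c : 'I_p./2.+1) : K := whittaker_ext m I phi (gapgen K (bC c)).

Lemma charge0 : charge ord0 = #|I|%:R.
Proof. by rewrite /charge whittaker_ext_gen. Qed.

Lemma charge_centridx i : charge (centridx i) = level i.
Proof. by rewrite /charge whittaker_extC. Qed.

Lemma mode_op_out n i f : i \notin I -> mode_op n i f = 0.
Proof. exact: fock_out. Qed.

Lemma mode_op_swap n i r j f : mode_op n i (mode_op r j f) =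
  mode_op r j (mode_op n i f) + heis_cocycle level n i r j *: f.
Proof. exact: (fock_swap _ I_sym level_opp level_out). Qed.

Lemma mode_op_smooth f :
  exists N : nat, forall n i, N%:Z <= n -> mode_op n i f = 0.
Proof. by apply: fock_smooth => //; exists m. Qed.

Definition fock_module : lie_module (gapvir K p) P :=
  sugawara_module I_sym level_opp level_neq0 mode_op_out mode_op_swap
    mode_op_smooth charge0 charge_centridx.

Lemma fock_module_I n i f : fock_module (Igen K n i) f = mode_op n i f.
Proof. exact: gap_act_gen. Qed.

Lemma fock_module_L n f :
  fock_module (Lgen K p n) f = sugawara I level mode_op n f.
Proof. exact: gap_act_gen. Qed.

Lemma fock_module_bC c f : fock_module (gapgen K (bC c)) f = charge c *: f.
Proof. exact: gap_act_gen. Qed.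

Lemma fock_module_C i f : fock_module (Cgen K i) f = level i *: f.
Proof. by rewrite fock_module_bC charge_centridx. Qed.

Lemma mode_op_creation v f :
  mode_op (- (tvar_deg v)%:Z) (tvar_idx v) f = pvar K v * f.
Proof.
have [vn vi] := andP (valP v); rewrite mode_opE.
have -> : - (tvar_deg v)%:Z = Negz (tvar_deg v).-1 by lia.
have [w wE ->] := fock_negz level (fun n i => phi (Igen K n i)) (tvar_deg v).-1 vi.
have -> : w = v by apply: val_inj; rewrite wE prednK//; case: (val v).
by [].
Qed.

Lemma mode_op_annihilation v f (n := tvar_deg v) (i := tvar_idx v) :
  mode_op (n%:Z - 1) (gapidx_opp i) f =
  (phi (Cgen K i) * (n%:R - i%:R / p%:R)) *: pderiv v f
  + phi (Igen K (n%:Z - 1) (gapidx_opp i)) *: f.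
Proof.
have [vn vi] := andP (valP v); rewrite mode_opE -/n.
have e : n%:Z - 1 = n.-1%:Z by rewrite /n; lia.
have [w wE fE] := @fock_posz K p I level (fun n i => phi (Igen K n i)) I_sym
  n.-1 _ (I_sym vi).
rewrite {1}e fE.
have -> : w = v.
  by apply: val_inj; rewrite wE prednK// gapidx_oppK /n; case: (val v).
have -> : level (gapidx_opp i) * mode K n.-1 (gapidx_opp i) =
    phi (Cgen K i) * (n%:R - i%:R / p%:R).
  rewrite level_opp /level vi; congr (_ * _).
  have -> : n.-1%:Z = - (- n%:Z) - 1 by rewrite /n; lia.
  by rewrite mode_opp /mode mulrNz -pmulrn; ring.
by rewrite -e.
Qed.

Lemma normal_ordered_nord j k l f :
  normal_ordered fock_module j k l f = nord mode_op j k l f.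
Proof. by rewrite /normal_ordered /nord !fock_module_I. Qed.

Lemma fock_sugawara n f :
  (forall j, j \in I -> finite_set
     [set k : int | normal_ordered fock_module j k (n - k - 1) f != 0]) /\
  fock_module (Lgen K p n) f =
    \sum_(j in I) (2 * phi (Cgen K j))^-1 *:
      (\sum_(k \in [set: int]) normal_ordered fock_module j k (n - k - 1) f)
    + ((n == 0)%:R * \sum_(j in I)
         (gapidx_nat j)%:R * (p - gapidx_nat j)%N%:R / (4 * p%:R ^+ 2)) *: f.
Proof.
split=> [j _|].
  have := nord_quad_finite mode_op_smooth j n f.
  by under eq_set do rewrite -normal_ordered_nord.
rewrite fock_module_L.
have q j : j \in I -> \sum_(k \in [set: int])
    normal_ordered fock_module j k (n - k - 1) f = quad mode_op j n f.
  by move=> _; apply: eq_fsbigr => k _; rewrite normal_ordered_nord.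
have c j : j \in I -> phi (Cgen K j) = level j by rewrite /level => ->.
exact: (sugawara_eq c q).
Qed.

Lemma fock_submodule_pvar W v f : is_submodule fock_module W -> W f ->
  W (pvar K v * f).
Proof.
move=> [_ WA] Wf; rewrite -mode_op_creation -fock_module_I.
exact: WA.
Qed.

(** The coefficient [l_i (n - i / p)] of the derivative is nonzero because
    [n p >= p > i]. *)
Lemma fock_submodule_pderiv W v f : is_submodule fock_module W -> W f ->
  W (pderiv v f).
Proof.
move=> [Wsub WA] Wf.
have [vn vi] := andP (valP v).
have := WA (Igen K ((tvar_deg v)%:Z - 1) (gapidx_opp (tvar_idx v))) f Wf.
rewrite fock_module_I mode_op_annihilation.
apply: subspace_affine => //.
rewrite mulf_neq0 ?phi_central//.
have ip := gapidx_lt (tvar_idx v).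
have p0 : p%:R != 0 :> K by rewrite pnatr_eq0; lia.
rewrite subr_eq0; apply: contraTneq vn => ni.
have : (tvar_deg v * p)%N%:R = (tvar_idx v)%:R :> K by rewrite natrM ni divfK.
by move=> /eqP; rewrite eqr_nat => /eqP; nia.
Qed.

Lemma fock_submodule_full W f : is_submodule fock_module W -> W f -> f != 0 ->
  W = [set: P].
Proof.
move=> subW Wf f0; have [Wsub _] := subW.
apply: invariant_pvar_full => // [v g|]; first exact: fock_submodule_pvar.
apply: (invariant_pderiv_1 Wsub _ f0 Wf) => v g.
exact: fock_submodule_pderiv.
Qed.

Lemma fock_irreducible : irreducible_module fock_module.
Proof.
split=> [|W subW]; first by exists 1; exact: oner_neq0.
have [[f Wf f0]|W0] := pselect (exists2 f, W f & f != 0).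
  by right; exact: fock_submodule_full f0.
left; apply/seteqP; split=> [f Wf|_ ->]; last by case: subW => -[].
by apply: contrapT => /eqP f0; apply: W0; exists f.
Qed.

Lemma mode_op_vacuum (n : nat) i : i \in I ->
  mode_op n i 1 = phi (Igen K n i) *: 1.
Proof.
move=> iI; rewrite mode_opE.
have [v _ ->] := @fock_posz K p I level (fun n i => phi (Igen K n i)) I_sym n _ iI.
have d1 : pderiv v (1 : P) = 0.
  apply/malgP => mu; rewrite mcoeff_pderiv mcoeff0 mcoeff1 cmM_eq1 cm1_eq1.
  by rewrite andbF mulr0.
by rewrite /fock_annihilation d1 scaler0 add0r.
Qed.

Context (m_gt0 : (0 < m)%N).

Lemma fock_whittaker_vector x : gap_pos K p m x ->
  fock_module x 1 = whittaker_ext m I phi x *: 1.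
Proof.
have e0 : whittaker_ext m I phi 0 = 0.
  by rewrite /whittaker_ext lin_extE msupp0 big_seq_fset0.
move: x; apply: smallest_sub => [|x]; first split.
- by rewrite e0 scale0r; exact: linear_prop0 (act_linearl fock_module 1).
- move=> a x y hx hy.
  rewrite (act_linearl fock_module) hx hy /whittaker_ext lin_ext_linear.
  by rewrite scalerDl scalerA.
move=> [[k ->]|[k [i ->]]|->|[i ->]].
- rewrite fock_module_L whittaker_ext_gen.
  rewrite [LHS](@sugawara_whittaker _ _ _ _ level mode_op
    (fun n i => phi (Igen K n i)) m 1 I_sym mode_op_vacuum phi_large (m + k)
    m_gt0 (leq_addr k m)).
  suff -> : whittaker_ext_basis m I phi (bL (m + k)%N%:Z) =
    if (m + k <= 2 * m)%N then \sum_(j in I) (2 * level j)^-1 *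
      \sum_(l < m) phi (Igen K l j)
        * phi (Igen K ((m + k)%N%:Z - l%:Z - 1) (gapidx_opp j)) else 0 by [].
  rewrite /whittaker_ext_basis lez_nat leq_addr andTb lez_nat.
  by case: ifP => // _; apply: eq_bigr => j jI; rewrite /level jI.
- rewrite fock_module_I whittaker_ext_gen /whittaker_ext_basis le0z_nat andTb.
  have [iI|iI] := boolP (i \in I); first exact: mode_op_vacuum.
  by rewrite mode_op_out// scale0r.
- exact: fock_module_bC.
- by rewrite fock_module_C whittaker_extC.
Qed.

Lemma fock_whittaker_module :
  whittaker_module (gap_pos K p m) (whittaker_ext m I phi) fock_module.
Proof.
split; last first.
  exists 1; split; first exact: fock_whittaker_vector.
  have one1 : smallest (is_submodule fock_module) [set 1 : P] 1.
    exact: sub_gen_smallest.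
  apply: fock_submodule_full one1 (oner_neq0 _).
  split; first split.
  - by move=> W [[[W0 _] _] _].
  - move=> a f g Wf Wg W WW; apply: WW.1.1.2; first exact: Wf.
    exact: Wg.
  by move=> x f Wf W WW; apply: WW.1.2; exact: Wf.
split=> [a x y _ _|x y]; first by rewrite /whittaker_ext lin_ext_linear.
exact: (eigenvector_lie (oner_neq0 _) fock_whittaker_vector).
Qed.

End FockModule.

Theorem proposition3p4 (R : realType) (p m : nat) (I : {set gapidx p})
    (phi : gapvir R[i] p -> R[i])
    (p_gt1 : (1 < p)%N) (m_gt0 : (0 < m)%N)
    (I_neq0 : I != finset.set0) (I_sym : symmetrical I)
    (phi_whittaker : whittaker_function (heis_plus R[i] I) phi)
    (phi_central : forall i, i \in I -> phi (Cgen R[i] i) != 0)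
    (phi_large : forall (n : nat) i,
       i \in I -> (m <= n)%N -> phi (Igen R[i] n i) = 0) :
  exists A : lie_module (gapvir R[i] p) (polyring R[i] (tvar I)),
    (forall (v : tvar I) f,
       let n : nat := tvar_deg v in let i : gapidx p := tvar_idx v in
       A (Igen R[i] (- n%:Z) i) f = pvar R[i] v * f /\
       A (Igen R[i] (n%:Z - 1) (gapidx_opp i)) f =
         (phi (Cgen R[i] i) * (n%:R - i%:R / p%:R)) *: pderiv v f
         + phi (Igen R[i] (n%:Z - 1) (gapidx_opp i)) *: f) /\
    (forall i f, i \in I -> A (Cgen R[i] i) f = phi (Cgen R[i] i) *: f) /\
    (forall (n : int) j f, j \notin I ->
       A (Igen R[i] n j) f = 0 /\ A (Cgen R[i] j) f = 0) /\
    (forall f, A (C0gen R[i] p) f = #|I|%:R *: f) /\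
    (forall (n : int) f,
       (forall j, j \in I -> finite_set
          [set k : int | normal_ordered A j k (n - k - 1) f != 0]) /\
       A (Lgen R[i] p n) f =
         \sum_(j in I) (2 * phi (Cgen R[i] j))^-1 *:
           (\sum_(k \in [set: int]) normal_ordered A j k (n - k - 1) f)
         + ((n == 0)%:R * \sum_(j in I)
              (gapidx_nat j)%:R * (p - gapidx_nat j)%N%:R / (4 * p%:R ^+ 2))
           *: f) /\
    irreducible_module A /\
    whittaker_module (gap_pos R[i] p m) (whittaker_ext m I phi) A.
Proof.
exists (fock_module I_sym phi_central phi_large).
split; [|split; [|split; [|split; [|split; [|split]]]]].
- move=> v f n i; rewrite !fock_module_I; split.
    exact: mode_op_creation.
  exact: mode_op_annihilation.
- by move=> i f iI; rewrite fock_module_C /level iI.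
- move=> n j f jI; rewrite fock_module_I fock_module_C; split.
    exact: mode_op_out.
  by rewrite /level (negPf jI) scale0r.
- by move=> f; rewrite fock_module_bC charge0.
- exact: fock_sugawara.
- exact: fock_irreducible.
- exact: fock_whittaker_module.
Qed.
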